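(* Let $\{X_n,n\geq1\}$ be a $\varphi$-mixing sequence of random variables with common marginal distribution function $F$, whose mixing coefficients satisfy $\varphi(n)=O(n^{-3})$, and assume $P(X_i=X_j)=0$ for all $i\neq j$. Fix $p\in(0,1)$, let $\xi_p=\inf\{x:F(x)\geq p\}$ and $\xi_{p,n}=\inf\{x:F_n(x)\geq p\}$. Assume that $F$ possesses a positive continuous density $f$ in a neighborhood $\mathscr{N}_p$ of $\xi_p$ such that $0<\sup\{f(x):x\in\mathscr{N}_p\}<\infty$, and that $f'$ exists and is bounded on $\mathscr{N}_p$. Then with probability 1, $$\xi_{p,n}=\xi_p-\frac{F_n(\xi_p)-p}{f(\xi_p)}+O\big(n^{-3/4}\log n\big),\quad n\to\infty.$$
   Context: All random variables are defined on a probability space $(\Omega,\mathcal{F},P)$. $F_n(x)=\frac1n\sum_{i=1}^n I(X_i\leq x)$ is the empirical distribution function of $X_1,\dots,X_n$. For $n\leq m$ let $\mathcal{F}_n^m=\sigma(X_i,n\leq i\leq m)$. For sub-$\sigma$-algebras $\mathcal{B},\mathcal{R}$ let $\varphi(\mathcal{B},\mathcal{R})=\sup_{A\in\mathcal{B},B\in\mathcal{R},P(A)>0}|P(B\mid A)-P(B)|$, and the mixing coefficients are $\varphi(n)=\sup_{k\geq1}\varphi(\mathcal{F}_1^k,\mathcal{F}_{k+n}^\infty)$. The sequence is called $\varphi$-mixing if $\varphi(n)\downarrow0$ as $n\to\infty$. *)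

(* Defs.v *)
From HB Require Import structures.
From mathcomp Require Import all_boot all_order all_algebra.
From mathcomp Require Import all_classical all_reals all_analysis.
Set Implicit Arguments. Unset Strict Implicit. Unset Printing Implicit Defensive.
Import Order.TTheory GRing.Theory Num.Theory.
Import numFieldNormedType.Exports.
Local Open Scope classical_set_scope.
Local Open Scope ring_scope.

Section Defs.
Context (d : measure_display) (T : measurableType d) (R : realType).

Definition sigmaX (X : nat -> T -> R) (I : set nat) : set (set T) :=
  smallest (sigma_algebra setT)
    [set A | exists i, I i /\ exists B : set R, measurable B /\ A = X i @^-1` B].

Definition phi_sigma (P : probability T R) (B C : set (set T)) : R :=
  sup [set r | exists A E, B A /\ C E /\ (0 < P A)%E /\
        r = `| fine (P (A `&` E)) / fine (P A) - fine (P E) |].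

Definition phi_mix (P : probability T R) (X : nat -> T -> R) (n : nat) : R :=
  sup [set r | exists k, (1 <= k)%N /\
        r = phi_sigma P (sigmaX X [set i | (1 <= i <= k)%N])
                        (sigmaX X [set i | (k + n <= i)%N])].

Definition emp_df (X : nat -> T -> R) (n : nat) (w : T) (x : R) : R :=
  (n%:R)^-1 * \sum_(1 <= i < n.+1) ((X i w <= x)%R : bool)%:R.

End Defs.

Definition quantile (R : realType) (G : R -> R) (p : R) : R :=
  inf [set x | p <= G x].

(* Main.v *)
Require Import Defs.
From HB Require Import structures.
From mathcomp Require Import all_boot all_order all_algebra.
From mathcomp Require Import all_classical all_reals all_analysis.
From mathcomp Require Import ring lra zify.
Set Implicit Arguments. Unset Strict Implicit. Unset Printing Implicit Defensive.
Import Order.TTheory GRing.Theory Num.Theory.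
Import numFieldNormedType.Exports.
Local Open Scope classical_set_scope.
Local Open Scope ring_scope.

(** With q ~ n^(1/4) and L = log n, everything follows from a Bernstein-type
    bound for the sums of n indicators of {X_i in B}, P(X_i in B) = beta: for
    t <= 1/(2q), the exponential moment at t of the centred sum is at most
    exp (K + K t^2 n beta).  The n terms are split into blocks of length q, and
    the odd and even blocks are treated separately.  phi-mixing makes the
    exponential moment of a family of blocks at distance q at most the product
    of the block moments up to a factor (1 + O(phi(q))) per block; as there are
    O(q^3) blocks and phi(q) = O(q^-3), the total loss is a constant.  This is
    where the rate n^-3 is used.

    Taking t ~ q^-2 and B = ]-oo, xi] gives F_n(xi) - p = O(L / q^2) almost
    surely; taking t ~ 1/q and B between xi and the points of the grid
    xi + q^-3 Z at distance O(L / q^2) from xi, whose probability is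
    O(L / q^2), gives increments of F_n - F of order L / q^3 at all these
    points, by Borel-Cantelli.  The grid points next to
    xi - (F_n(xi) - p) / f(xi) +- K L / q^3 then lie on either side of the
    empirical quantile. *)

(** * Elementary inequalities and rearrangements of sums *)

Lemma expR_le_quad (R : realType) (x : R) : x <= 1 -> expR x <= 1 + x + 2 * x ^+ 2.
Proof.
move=> x1.
have h := expR_ge1Dx (- (x / 2)).
have e0 : 0 < expR (- (x / 2)) by exact: expR_gt0.
have -> : expR x = (expR (- (x / 2))) ^- 2.
  rewrite -expRM_natl -expRN; congr expR; by rewrite -mulr_natl; field.
rewrite invf_ple ?posrE ?exprn_gt0//; last nra.
apply: (@le_trans _ _ ((1 - x / 2) ^+ 2)); last by rewrite ler_sqr ?nnegrE; lra.
rewrite -[leLHS]mul1r ler_pdivrMr; last nra.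
(* The exponential is at most the inverse of (1 - x/2)^2, so that (1 + x + 2x^2)(1 - x/2)^2 >= 1
   remains; the difference of the two sides is this product. *)
have : 0 <= x ^+ 2 * ((1 - x) * (5 / 4 - x / 2)).
  by apply: mulr_ge0; [exact: sqr_ge0|apply: mulr_ge0; lra].
lra.
Qed.

Lemma sum_double_block (V : nmodType) (z : nat -> V) (q J : nat) :
  \sum_(0 <= i < 2 * q * J) z i =
  \sum_(0 <= l < J) \sum_(0 <= i < q) z (2 * q * l + i)%N +
  \sum_(0 <= l < J) \sum_(0 <= i < q) z (q + 2 * q * l + i)%N.
Proof.
elim: J => [|J IH]; first by rewrite muln0 !big_geq// addr0.
rewrite !big_nat_recr//= (@big_cat_nat _ _ _ (2 * q * J)) /=; [|by []|by lia].
rewrite IH addrACA; congr (_ + _).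
rewrite (@big_cat_nat _ _ _ (2 * q * J + q)) /=; [|by lia|by lia].
congr (_ + _).
  rewrite -{1}[(2 * q * J)%N]add0n big_addn (_ : _ - _ = q)%N; last lia.
  by apply: eq_bigr => i _; congr z; lia.
rewrite -{1}[(2 * q * J + q)%N]add0n big_addn (_ : _ - _ = q)%N; last lia.
by apply: eq_bigr => i _; congr z; lia.
Qed.

(** Each distance occurs at most twice among the j < q, once on either side of i. *)
Lemma sum_dist_le (R : realType) (rho : nat -> R) (S : R) (q i : nat) :
  (forall k, 0 <= rho k) -> (forall m, \sum_(0 <= k < m) rho k <= S) ->
  (i < q)%N -> \sum_(0 <= j < q) rho ((i - j) + (j - i))%N <= 2 * S.
Proof.
move=> rho0 hS iq.
rewrite (@big_cat_nat _ _ _ i.+1)//= mulr_natl mulr2n; apply: lerD.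
  rewrite big_nat_rev /=; apply: le_trans (hS i.+1).
  by rewrite le_eqVlt; apply/orP; left; apply/eqP; apply: eq_big_nat => j ji; congr rho; lia.
rewrite -{1}[i.+1]add0n big_addn.
apply: le_trans (hS (q - i.+1).+1).
rewrite [leRHS]big_nat_recl//.
apply: ler_wpDl => //; rewrite le_eqVlt; apply/orP; left; apply/eqP.
by apply: eq_big_nat => j ji; congr rho; lia.
Qed.

(** * Exponential moments of block sums on a finite probability space *)

Section finite_expectation.
Variables (R : realType) (Om : finType) (mu : Om -> R).
Hypothesis mu0 : forall t, 0 <= mu t.

(** Only the indicators of finitely many events {X_i in B} enter, so moments are taken under their
    joint law, a weight [mu] on a finite type; expectations are then finite sums, free of
    integrability questions. *)
Definition pr (A : pred Om) : R := \sum_(t | A t) mu t.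
Definition ex (g : Om -> R) : R := \sum_t mu t * g t.

Lemma ex_le (g h : Om -> R) : (forall t, g t <= h t) -> ex g <= ex h.
Proof. by move=> gh; apply: ler_sum => t _; exact: ler_wpM2l. Qed.

Lemma ex_ge0 (g : Om -> R) : (forall t, 0 <= g t) -> 0 <= ex g.
Proof. by move=> g0; apply: sumr_ge0 => t _; exact: mulr_ge0. Qed.

Lemma ex_markov (g : Om -> R) (A : pred Om) (c : R) : 0 < c ->
  (forall t, 0 <= g t) -> (forall t, A t -> c <= g t) -> pr A <= ex g / c.
Proof.
move=> c0 g0 Ag; rewrite ler_pdivlMr// /pr big_distrl/= /ex big_mkcond/=.
apply: ler_sum => t _; case: ifP => [/Ag h|_]; first exact: ler_wpM2l.
exact: mulr_ge0.
Qed.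

(* For each [a], the sum of [v <= M] against the signed measure
   [pr (r1 = a, r2 = .) - pr (r1 = a) * pr (r2 = .)] is at most [M] times its
   mass on the set where it is positive. *)
Lemma ex_prod_le (O1 O2 : finType) (r1 : Om -> O1) (r2 : Om -> O2)
    (u : O1 -> R) (v : O2 -> R) (M phi : R) :
  (forall a, 0 <= u a) -> (forall e, 0 <= v e <= M) -> 0 <= M ->
  (forall (a : O1) (E : pred O2),
     pr [pred t | (r1 t == a) && E (r2 t)] <=
     pr [pred t | r1 t == a] * (pr [pred t | E (r2 t)] + phi)) ->
  ex (fun t => u (r1 t) * v (r2 t)) <=
  ex (fun t => u (r1 t)) * (ex (fun t => v (r2 t)) + M * phi).
Proof.
move=> u0 v0 M0 H.
pose J a e := pr [pred t | (r1 t == a) && (r2 t == e)].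
pose p1 a := pr [pred t | r1 t == a].
pose p2 e := pr [pred t | r2 t == e].
have exv : ex (fun t => v (r2 t)) = \sum_e v e * p2 e.
  rewrite /ex (partition_big r2 predT)//=; apply: eq_bigr => e _.
  by rewrite /p2 /pr big_distrr/=; apply: eq_bigr => t /eqP ->; rewrite mulrC.
have exu : ex (fun t => u (r1 t)) = \sum_a u a * p1 a.
  rewrite /ex (partition_big r1 predT)//=; apply: eq_bigr => a _.
  by rewrite /p1 /pr big_distrr/=; apply: eq_bigr => t /eqP ->; rewrite mulrC.
have exuv : ex (fun t => u (r1 t) * v (r2 t)) = \sum_a u a * \sum_e v e * J a e.
  rewrite /ex (partition_big r1 predT)//=; apply: eq_bigr => a _.
  rewrite (partition_big r2 predT)//= big_distrr/=; apply: eq_bigr => e _.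
  rewrite /J /pr !big_distrr/=; apply: eq_bigr => t /andP[/eqP -> /eqP ->].
  by rewrite mulrC mulrA.
rewrite exuv exu big_distrl/=; apply: ler_sum => a _.
rewrite -mulrA; apply: ler_wpM2l => //.
rewrite exv mulrDr -lerBlDl big_distrr/= -sumrB.
pose E : pred O2 := fun e => 0 < J a e - p1 a * p2 e.
apply: (@le_trans _ _ (\sum_(e | E e) M * (J a e - p1 a * p2 e))).
  rewrite [leRHS]big_mkcond/=; apply: ler_sum => e _.
  rewrite mulrCA -mulrBr; case: ifP => [Ee|/negbT].
    by apply: ler_wpM2r; [exact: ltW|case/andP: (v0 e)].
  by rewrite -leNgt => h; apply: mulr_ge0_le0 => //; case/andP: (v0 e).
rewrite -big_distrr/= mulrCA; apply: ler_wpM2l => //.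
rewrite sumrB lerBlDl -big_distrr/= -mulrDr.
have -> : \sum_(e | E e) J a e = pr [pred t | (r1 t == a) && E (r2 t)].
  rewrite /pr (partition_big r2 E)/=; last by move=> t /andP[].
  apply: eq_bigr => e Ee; rewrite /J /pr; apply: eq_bigl => t /=.
  by case: eqP => //= _; case: eqP => [->|]; rewrite ?andbT ?andbF.
have -> : \sum_(e | E e) p2 e = pr [pred t | E (r2 t)].
  rewrite /pr (partition_big r2 E)//=.
  apply: eq_bigr => e Ee; rewrite /p2 /pr; apply: eq_bigl => t /=.
  by case: eqP => [->|]; rewrite ?andbT ?andbF.
exact: H.
Qed.

End finite_expectation.

(** * Exponential moments of sums over separated blocks *)

Section blocks.
Variables (R : realType) (N : nat) (mu : N.-tuple bool -> R).
Hypothesis mu0 : forall t, 0 <= mu t.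
Hypothesis mu1 : \sum_t mu t = 1.

Definition bit (t : N.-tuple bool) (i : nat) : bool := nth false t i.

(** Bits outside [I] are overwritten by [false] rather than removed: past and future then live in
    one type of tuples, whatever the positions kept. *)
Definition restr (I : pred nat) (t : N.-tuple bool) : N.-tuple bool :=
  [tuple I i && tnth t i | i < N].

Lemma bit_restr I t i : bit (restr I t) i = I i && bit t i.
Proof.
rewrite /bit; have [iN|Ni] := ltnP i N; last first.
  by rewrite !nth_default ?size_tuple// andbF.
by rewrite -[i in LHS]/(nat_of_ord (Ordinal iN)) nth_mktuple (tnth_nth false).
Qed.

(* The weights [c] are used to truncate a sum of 2qJ terms to its first n terms. *)
Variables (c : nat -> R) (beta : R).
Hypothesis c01 : forall i, 0 <= c i <= 1.
Hypothesis beta01 : 0 <= beta <= 1.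

Definition wsum (a q : nat) (t : N.-tuple bool) : R :=
  \sum_(0 <= i < q) c (a + i)%N * ((bit t (a + i))%:R - beta).

Lemma wsum_restr (I : pred nat) a q t :
  (forall i, (a <= i < a + q)%N -> I i) -> wsum a q (restr I t) = wsum a q t.
Proof.
move=> HI; apply: eq_big_nat => i /andP[_ iq].
by rewrite bit_restr HI// leq_addr ltn_add2l.
Qed.

Lemma normr_wsum_le a q t : `|wsum a q t| <= q%:R.
Proof.
apply: le_trans (ler_norm_sum _ _ _) _.
apply: (@le_trans _ _ (\sum_(0 <= i < q) 1)); last by rewrite big_const_nat subn0 iter_addr addr0.
apply: ler_sum => i _; rewrite normrM -[leRHS]mul1r.
apply: ler_pM => //; first by case/andP: (c01 (a + i)) => ? ?; rewrite ger0_norm.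
by case/andP: beta01 => ? ?; rewrite ler_norml; case: (bit t _) => /=; lra.
Qed.

Variables (q : nat) (rho : nat -> R) (S : R).
Hypothesis rho0 : forall k, 0 <= rho k.
Hypothesis rhoS : forall m, \sum_(0 <= k < m) rho k <= S.
Hypothesis mean : forall i, (i < N)%N -> pr mu [pred t | bit t i] = beta.
(** With truncated subtraction, [(i - j) + (j - i)] is the distance between i and j. The factor
    [beta] in front is what phi-mixing provides; it keeps the variance of a sum of order [beta]
    times its length. *)
Hypothesis cov : forall i j, (i < N)%N -> (j < N)%N ->
  pr mu [pred t | bit t i && bit t j] <= beta * (beta + rho ((i - j) + (j - i))%N).

Lemma ex_bit A : ex mu (fun t => (A t : bool)%:R) = pr mu [pred t | A t].
Proof.
rewrite /ex /pr [RHS]big_mkcond/=; apply: eq_bigr => t _.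
by case: (A t); rewrite ?mulr1 ?mulr0.
Qed.

Lemma ex_wsum a : (a + q <= N)%N -> ex mu (wsum a q) = 0.
Proof.
move=> aq; rewrite /ex /wsum.
under eq_bigr do rewrite big_distrr/=.
rewrite exchange_big/= big_nat big1// => i /andP[_ iq].
transitivity (c (a + i)%N * (ex mu (fun t => (bit t (a + i))%:R) - beta * \sum_t mu t)).
  rewrite /ex mulr_sumr -sumrB mulr_sumr; apply: eq_bigr => t _; ring.
by rewrite ex_bit mean ?mu1; [ring|lia].
Qed.

(** After expanding the square, each covariance is at most [beta] times [rho] at the distance; the
    weights lie in [0, 1] and are bounded by 1, and for each i the sum over j is at most [2 * S]. *)
Lemma ex_wsum_sqr a : (a + q <= N)%N ->
  ex mu (fun t => wsum a q t ^+ 2) <= q%:R * beta * (2 * S).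
Proof.
move=> aq; case/andP: (beta01) => b0 b1.
have -> : ex mu (fun t => wsum a q t ^+ 2) =
    \sum_(0 <= i < q) \sum_(0 <= j < q) c (a + i)%N * c (a + j)%N *
     (ex mu (fun t => (bit t (a + i) && bit t (a + j))%:R) - beta ^+ 2).
  rewrite [LHS]/ex; under eq_bigr do
    rewrite expr2 {1}/wsum big_distrl/= big_distrr/=.
  rewrite exchange_big/= big_nat [RHS]big_nat; apply: eq_bigr => i /andP[_ iq].
  under eq_bigr do rewrite /wsum !big_distrr/=.
  rewrite exchange_big/= big_nat [RHS]big_nat; apply: eq_bigr => j /andP[_ jq].
  transitivity (c (a + i)%N * c (a + j)%N *
    (ex mu (fun t => (bit t (a + i) && bit t (a + j))%:R)
     - beta * ex mu (fun t => (bit t (a + i))%:R)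
     - beta * ex mu (fun t => (bit t (a + j))%:R) + beta ^+ 2 * \sum_t mu t)).
    rewrite /ex !(mulr_sumr _ _ _ beta) -!sumrB (mulr_sumr _ _ _ (beta ^+ 2)).
    rewrite -big_split/= mulr_sumr; apply: eq_bigr => t _.
    by rewrite -mulnb natrM; ring.
  rewrite !ex_bit !mean ?mu1; [|lia|lia].
  by congr (_ * _); ring.
apply: (@le_trans _ _ (\sum_(0 <= i < q) beta * (2 * S))); last first.
  by rewrite big_const_nat subn0 iter_addr addr0 -[leLHS]mulr_natl mulrA.
rewrite big_nat [leRHS]big_nat; apply: ler_sum => i /andP[_ iq].
apply: le_trans (_ : beta * (\sum_(0 <= j < q) rho ((i - j) + (j - i))%N) <= _);
  last by apply: ler_wpM2l => //; exact: sum_dist_le.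
rewrite mulr_sumr big_nat [leRHS]big_nat; apply: ler_sum => j /andP[_ jq].
have := @cov (a + i)%N (a + j)%N; rewrite ex_bit.
rewrite (_ : a + i - (a + j) + _ = i - j + (j - i))%N; last lia.
move=> /(_ ltac:(lia) ltac:(lia)) h.
apply: (@le_trans _ _ (c (a + i)%N * c (a + j)%N * (beta * rho (i - j + (j - i))%N))).
  apply: ler_wpM2l; last lra.
  by case/andP: (c01 (a + i)); case/andP: (c01 (a + j)) => *; exact: mulr_ge0.
rewrite -[leRHS]mul1r; apply: ler_wpM2r; first exact: mulr_ge0.
case/andP: (c01 (a + i)); case/andP: (c01 (a + j)) => *.
by rewrite -[leRHS]mul1r; apply: ler_pM.
Qed.

(** The exponent is at most 1, so [expR_le_quad] applies pointwise; the linear term vanishes by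
    centring and the quadratic one is the second moment. *)
Lemma ex_exp_wsum (s : R) a : `|s| * q%:R <= 1 -> (a + q <= N)%N ->
  ex mu (fun t => expR (s * wsum a q t)) <= 1 + 4 * S * s ^+ 2 * q%:R * beta.
Proof.
move=> sq aq.
apply: (@le_trans _ _ (ex mu (fun t => 1 + s * wsum a q t + 2 * (s * wsum a q t) ^+ 2))).
  apply: ex_le => // t; apply: expR_le_quad.
  apply: le_trans (ler_norm _) _; rewrite normrM; apply: le_trans sq.
  by apply: ler_wpM2l => //; exact: normr_wsum_le.
have -> : ex mu (fun t => 1 + s * wsum a q t + 2 * (s * wsum a q t) ^+ 2) =
   \sum_t mu t + s * ex mu (wsum a q) + 2 * s ^+ 2 * ex mu (fun t => wsum a q t ^+ 2).
  rewrite /ex !mulr_sumr -!big_split/=; apply: eq_bigr => t _; ring.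
rewrite mu1 ex_wsum// mulr0 addr0 lerD2l.
have := @ex_wsum_sqr _ aq; have := sqr_ge0 s => s2 h.
by apply: le_trans (ler_wpM2l _ h) _; [lra|rewrite le_eqVlt; apply/orP; left; apply/eqP; ring].
Qed.

Variable phi : R.
Hypothesis phi0 : 0 <= phi.
Hypothesis mix : forall (k : nat) (a : N.-tuple bool) (E : pred (N.-tuple bool)),
  pr mu [pred t | (restr (fun i => (i < k)%N) t == a) &&
                  E (restr (fun i => (k + q <= i)%N) t)] <=
  pr mu [pred t | restr (fun i => (i < k)%N) t == a] *
  (pr mu [pred t | E (restr (fun i => (k + q <= i)%N) t)] + phi).

(** Blocks are added one at a time: [ex_prod_le] separates the new block from the earlier ones at
    the cost of [4 * phi], where 4 bounds its exponential. The length [2 * q * J] counts a gap after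
    the last block, which may lie beyond N; hence [N + q]. *)
Lemma ex_alternate_blocks (s : R) (o J : nat) : `|s| * q%:R <= 1 ->
  (o + 2 * q * J <= N + q)%N ->
  ex mu (fun t => expR (s * \sum_(0 <= l < J) wsum (o + 2 * q * l) q t)) <=
  expR (J%:R * (4 * S * s ^+ 2 * q%:R * beta + 4 * phi)).
Proof.
move=> sq oJ.
have S0 : 0 <= S by have := rhoS 0; rewrite big_geq.
case/andP: (beta01) => b0 b1.
have [y yE] : exists y : R, y = 4 * S * s ^+ 2 * q%:R * beta by eexists.
have y0 : 0 <= y.
  rewrite yE.
  by have := sqr_ge0 s => s2; do 3 (apply: mulr_ge0 => //); apply: mulr_ge0. 
have [x xE] : exists x : R, x = y + 4 * phi by eexists.
rewrite -yE -xE.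
have x1 : 0 <= 1 + x by have := phi0; lra.
have yx : y <= x by have := phi0; lra.
pose V l t := expR (s * wsum (o + 2 * q * l) q t).
have Vle l t : V l t <= 4.
  apply: (@le_trans _ _ (expR 1)); last by have := @expR_le_quad R 1; lra.
  rewrite ler_expR; apply: le_trans (ler_norm _) _; rewrite normrM; apply: le_trans sq.
  by apply: ler_wpM2l => //; exact: normr_wsum_le.
have EV l : (l < J)%N -> ex mu (V l) <= 1 + y.
  move=> lJ; rewrite yE; apply: ex_exp_wsum => //.
  have : (2 * q * l.+1 <= 2 * q * J)%N by rewrite leq_mul2l lJ orbT.
  by lia.
have key j : (j <= J)%N -> ex mu (fun t => \prod_(0 <= l < j) V l t) <= (1 + x) ^+ j.
  elim: j => [|j IH] jJ.
    rewrite expr0 -[leRHS]mu1 /ex; apply: ler_sum => t _.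
    by rewrite big_geq// mulr1.
  rewrite exprSr; apply: (@le_trans _ _
    (ex mu (fun t => \prod_(0 <= l < j) V l t) * (1 + x))); last first.
    by apply: ler_wpM2r; [exact: x1|exact/IH/ltnW].
  (* The first block has no predecessor to be separated from and is bounded directly. *)
  case: j => [|j] in IH jJ *.
    have -> : ex mu (fun t => \prod_(0 <= l < 1) V l t) = ex mu (V 0%N).
      by apply: eq_bigr => t _; rewrite big_nat1.
    have -> : ex mu (fun t => \prod_(0 <= l < 0) V l t) = 1.
      by rewrite -[RHS]mu1; apply: eq_bigr => t _; rewrite big_geq// mulr1.
    rewrite mul1r; apply: le_trans (EV _ jJ) _; lra.
  (* [k] is the end of block j, and block j + 1 starts at [k + q]. *)
  pose k := (o + 2 * q * j + q)%N.
  pose U t := \prod_(0 <= l < j.+1) V l t.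
  have U1 t : U (restr (fun i => (i < k)%N) t) = U t.
    apply: eq_big_nat => l /andP[_ lj]; rewrite /V wsum_restr// => i.
    by have := leq_mul2l (2 * q) l j; rewrite /k; lia.
  have V1 t : V j.+1 (restr (fun i => (k + q <= i)%N) t) = V j.+1 t.
    by rewrite /V wsum_restr// => i; rewrite /k; lia.
  have := @ex_prod_le R _ mu _ _ (restr (fun i => (i < k)%N))
    (restr (fun i => (k + q <= i)%N)) U (V j.+1) 4 phi.
  have -> : (fun t => U (restr (fun i => (i < k)%N) t)) = U by apply/funext.
  have -> : (fun t => V j.+1 (restr (fun i => (k + q <= i)%N) t)) = V j.+1
    by apply/funext.
  have -> : (fun t => U (restr (fun i => (i < k)%N) t) *
     V j.+1 (restr (fun i => (k + q <= i)%N) t)) =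
     (fun t => \prod_(0 <= l < j.+2) V l t).
    by apply/funext => t; rewrite U1 V1 big_nat_recr.
  have U0 t : 0 <= U t by apply: prodr_ge0 => l _; exact: expR_ge0.
  move=> /(_ U0 _ _ (mix k)) h; apply: le_trans (h _ _) _ => //.
    by move=> e; rewrite Vle expR_ge0.
  apply: ler_wpM2l; first exact: ex_ge0.
  by have := EV _ jJ; lra.
have -> : ex mu (fun t => expR (s * \sum_(0 <= l < J) wsum (o + 2 * q * l) q t)) =
    ex mu (fun t => \prod_(0 <= l < J) V l t).
  by apply: eq_bigr => t _; rewrite mulr_sumr expR_sum.
apply: le_trans (key _ (leqnn J)) _; rewrite expRM_natl.
by apply: lerXn2r; rewrite ?nnegrE ?expR_ge0 ?expR_ge1Dx//; lra.
Qed.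

(** For the sums a and b over the two families of blocks, exp (s(a + b)) is at most the mean of exp
    (2sa) and exp (2sb). This reduces to [ex_alternate_blocks] at [2 * s], with offsets 0 and q. *)
Lemma ex_exp_sum (s : R) (J : nat) : N = (2 * q * J)%N -> 2 * `|s| * q%:R <= 1 ->
  ex mu (fun t => expR (s * \sum_(0 <= i < N) c i * ((bit t i)%:R - beta))) <=
  expR (J%:R * (16 * S * s ^+ 2 * q%:R * beta + 4 * phi)).
Proof.
move=> NJ sq.
have sq2 : `|2 * s| * q%:R <= 1 by rewrite normrM ger0_norm.
have := @ex_alternate_blocks _ 0%N J sq2; rewrite add0n => /(_ ltac:(lia)) h1.
have := @ex_alternate_blocks _ q J sq2 => /(_ ltac:(lia)) h2.
have e : 4 * S * (2 * s) ^+ 2 * q%:R * beta = 16 * S * s ^+ 2 * q%:R * beta by ring.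
rewrite e in h1 h2; set B := expR _ in h1 h2 *.
suff : ex mu (fun t => expR (s * \sum_(0 <= i < N) c i * ((bit t i)%:R - beta))) <=
   1/2 * ex mu (fun t => expR (2 * s * \sum_(0 <= l < J) wsum (2 * q * l) q t)) +
   1/2 * ex mu (fun t => expR (2 * s * \sum_(0 <= l < J) wsum (q + 2 * q * l) q t)).
  move=> /le_trans; apply; move: h1 h2; under eq_fun do under eq_bigr do rewrite add0n.
  by lra.
rewrite /ex !mulr_sumr -big_split/=; apply: ler_sum => t _.
rewrite mulrCA [X in _ <= _ + X]mulrCA -mulrDr; apply: ler_wpM2l => //.
rewrite [in X in \sum_(_ <= _ < X) _]NJ sum_double_block.
set a := \sum_(0 <= l < J) wsum (2 * q * l) q t.
set b := \sum_(0 <= l < J) wsum (q + 2 * q * l) q t.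
rewrite mulrDr expRD -!(mulrA 2) !expRM_natl.
by have := sqr_ge0 (expR (s * a) - expR (s * b)); lra.
Qed.

End blocks.

(** * Transfer to mixing sequences *)

(** The measurable type is arbitrary so that it can be T with the sigma-algebra generated by some of
    the X_i. *)
Lemma measurable_tuple_pred (d : measure_display) (S : measurableType d) (N : nat)
    (r : S -> N.-tuple bool) :
  (forall i : 'I_N, measurable [set w | tnth (r w) i]) ->
  forall A : pred (N.-tuple bool), measurable [set w | A (r w)].
Proof.
move=> mr A.
have -> : [set w | A (r w)] = \bigcup_(t in [set t | A t])
    \bigcap_(i in [set: 'I_N]) [set w | tnth (r w) i = tnth t i].
  apply/seteqP; split => [w Aw|w [t /= At rt]]; first by exists (r w).
  suff -> : r w = t by [].
  by apply: eq_from_tnth => i; exact: rt.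
apply: fin_bigcup_measurable => [|t _]; first exact: finite_finset.
apply: fin_bigcap_measurable => [|i _]; first exact: finite_finset.
case: (tnth t i); first exact: mr.
have -> : [set w | tnth (r w) i = false] = ~` [set w | tnth (r w) i].
  by apply/seteqP; split => w /= => [->//|/negP/negbTE].
exact/measurableC/mr.
Qed.

Section mixing.
Context (d : measure_display) (T : measurableType d) (R : realType).
Variables (P : probability T R) (X : nat -> T -> R).
Hypothesis mX : forall i, (1 <= i)%N -> measurable_fun setT (X i).

Let pE (A : set T) : R := fine (P A).

Lemma fine_prob_le1 (A : set T) : measurable A -> 0 <= pE A <= 1.
Proof.
move=> mA; rewrite fine_ge0//= -lee_fin /pE fineK ?fin_num_measure//.
exact: probability_le1.
Qed.

Lemma fine_prob_le (A B : set T) : measurable A -> measurable B -> A `<=` B -> pE A <= pE B.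
Proof.
by move=> mA mB AB; rewrite /pE fine_le ?fin_num_measure// le_measure ?inE.
Qed.

Lemma sigmaX_measurable (I : set nat) A :
  (forall i, I i -> (1 <= i)%N) -> sigmaX X I A -> measurable A.
Proof.
move=> I1; apply: smallest_sub.
  split; first exact: measurable0.
  - by move=> B mB; rewrite setTD; exact: measurableC.
  - by move=> F mF; exact: bigcupT_measurable.
move=> _ [i [Ii [B [mB ->]]]].
by rewrite -[_ @^-1` _]setTI; apply: mX => //; exact: I1.
Qed.

(** The bound by 1 makes the sets defining [phi_sigma] and [phi_mix] bounded above, so that their
    real [sup] is a genuine supremum. *)
Lemma phi_quotient_le1 (A E : set T) : measurable A -> measurable E ->
  (0 < P A)%E -> `| pE (A `&` E) / pE A - pE E | <= 1.
Proof.
move=> mA mE A0.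
have a0 : 0 < pE A by rewrite -lte_fin /pE fineK ?fin_num_measure.
have /andP[e0 e1] := fine_prob_le1 mE.
have /andP[i0 i1] := fine_prob_le1 (measurableI _ _ mA mE).
have ia : pE (A `&` E) <= pE A by apply: fine_prob_le => //; exact: measurableI.
have : 0 <= pE (A `&` E) / pE A <= 1.
  by rewrite divr_ge0 ?(ltW a0)//= ler_pdivrMr// mul1r.
by move=> /andP[? ?]; rewrite ler_norml; lra.
Qed.

Let past k := sigmaX X [set i | (1 <= i <= k)%N].
Let future k := sigmaX X [set i | (k <= i)%N].

Lemma past_measurable k A : past k A -> measurable A.
Proof. by apply: sigmaX_measurable => i /= /andP[]. Qed.

Lemma future_measurable k A : (1 <= k)%N -> future k A -> measurable A.
Proof. by move=> k1; apply: sigmaX_measurable => i /=; exact: leq_trans. Qed.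

Lemma sigmaX_setT I : sigmaX X I setT.
Proof.
have [h0 hC _] := smallest_sigma_algebra setT
  [set A | exists i, I i /\ exists B : set R, measurable B /\ A = X i @^-1` B].
by rewrite -(setD0 setT); exact: hC.
Qed.

Lemma phi_sigma_ub k g A E : (1 <= k)%N -> past k A -> future (k + g) E -> (0 < P A)%E ->
  `| pE (A `&` E) / pE A - pE E | <= phi_sigma P (past k) (future (k + g)) <= 1.
Proof.
move=> k1 pA fE A0.
have kg : (1 <= k + g)%N by lia.
have ub : ubound [set r | exists A E, past k A /\ future (k + g) E /\ (0 < P A)%E /\
        r = `| fine (P (A `&` E)) / fine (P A) - fine (P E) |] 1.
  move=> _ [A' [E' [pA' [fE' [A0' ->]]]]]; apply: phi_quotient_le1 => //.
    exact: past_measurable pA'.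
  exact: future_measurable fE'.
apply/andP; split.
  by apply: ub_le_sup; [exists 1|exists A, E].
apply: ge_sup => //; exists (`| pE (A `&` E) / pE A - pE E |).
by exists A, E.
Qed.

Lemma phi_sigma_le_mix k g : (1 <= k)%N ->
  phi_sigma P (past k) (future (k + g)) <= phi_mix P X g <= 1.
Proof.
move=> k1.
have P1 : (0 < P setT)%E by rewrite probability_setT.
have ub : ubound [set r | exists k, (1 <= k)%N /\
        r = phi_sigma P (sigmaX X [set i | (1 <= i <= k)%N])
                        (sigmaX X [set i | (k + g <= i)%N])] 1.
  move=> _ [j [j1 ->]].
  by have /andP[_ ->] := @phi_sigma_ub j g setT setT j1 (@sigmaX_setT _) (@sigmaX_setT _) P1.
apply/andP; split.
  by apply: ub_le_sup; [exists 1|exists k].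
by apply: ge_sup => //; eexists; exists k; split.
Qed.

Lemma mixing_event_le k g A E : (1 <= k)%N -> past k A -> future (k + g) E ->
  pE (A `&` E) <= pE A * (pE E + phi_mix P X g).
Proof.
move=> k1 pA fE.
have mA := past_measurable pA.
have kg : (1 <= k + g)%N by lia.
have mE := future_measurable kg fE.
have /andP[a0 a1] := fine_prob_le1 mA.
(* The mixing coefficient only concerns A of positive probability; for a null A both sides
   vanish. *)
have [A0|A0] := eqVneq (pE A) 0.
  rewrite A0 mul0r -A0; apply: fine_prob_le => //; exact: measurableI.
have PA : 0 < pE A by rewrite lt_neqAle eq_sym A0.
have PA' : (0 < P A)%E by rewrite -[P A]fineK ?fin_num_measure// lte_fin.
have /andP[h _] := phi_sigma_ub k1 pA fE PA'.
have /andP[h' _] := phi_sigma_le_mix g k1.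
have := le_trans (ler_norm _) (le_trans h h').
by rewrite lerBlDl ler_pdivrMr// mulrC addrC.
Qed.

Variables (B : set R) (N : nat).
Hypothesis mB : measurable B.

(** The sequence starts at X_1 and the bits at position 0, whence the shift of indices. *)
Definition bits (w : T) : N.-tuple bool := [tuple (X i.+1 w \in B) | i < N].

Definition law (t : N.-tuple bool) : R := pE [set w | bits w = t].

Lemma bit_bits w i : (i < N)%N -> bit (bits w) i = (X i.+1 w \in B).
Proof.
by move=> iN; rewrite /bit -[i in LHS]/(nat_of_ord (Ordinal iN)) nth_mktuple.
Qed.

Lemma sigmaX_restr (I : set nat) (J : pred nat) (A : pred (N.-tuple bool)) :
  (forall i, J i -> I i.+1) -> sigmaX X I [set w | A (restr J (bits w))].
Proof.
move=> JI.
pose G := [set A | exists i, I i /\ exists B : set R, measurable B /\ A = X i @^-1` B].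
(* T carries here the sigma-algebra generated by the X_i with i in [I], so that measurability means
   membership in [sigmaX X I]. *)
apply: (@measurable_tuple_pred _ (g_sigma_algebraType G) N
  (fun w => restr J (bits w))) => i.
have [Ji|Ji] := boolP (J i); last first.
  rewrite (_ : [set w | _] = set0); first exact: measurable0.
  by apply/seteqP; split => w //=; rewrite tnth_mktuple (negbTE Ji).
rewrite (_ : [set w | _] = X i.+1 @^-1` B).
  by apply: sub_sigma_algebra; exists i.+1; split; [exact: JI|exists B].
by apply/seteqP; split => w /=; rewrite tnth_mktuple Ji /= tnth_mktuple inE.
Qed.

Lemma measurable_bits (A : pred (N.-tuple bool)) : measurable [set w | A (bits w)].
Proof.
have -> : [set w | A (bits w)] = [set w | A (restr predT (bits w))].
  apply/seteqP; split => w /=; rewrite (_ : restr _ _ = bits w)//;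
  by apply: eq_from_tnth => i; rewrite tnth_mktuple.
apply: (@sigmaX_measurable [set i | (1 <= i)%N]) => //.
exact: sigmaX_restr.
Qed.

Lemma pr_law (A : pred (N.-tuple bool)) : pr law A = pE [set w | A (bits w)].
Proof.
have mt t : measurable [set w | bits w = t].
  rewrite (_ : [set w | _] = [set w | pred1 t (bits w)]); first exact: measurable_bits.
  by apply/seteqP; split => w /= /eqP.
have -> : [set w | A (bits w)] = \bigcup_(t in [set` enum A]) [set w | bits w = t].
  apply/seteqP; split => [w Aw|w [t /= At ->]]; last by rewrite mem_enum in At.
  by exists (bits w) => //=; rewrite mem_enum.
rewrite /pE measure_fin_bigcup//; last first.
  by apply/trivIsetP => t t' _ _ tt'; apply/seteqP; split => w //= [wt wt']; move: tt'; rewrite -wt -wt' eqxx.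
rewrite -fsbig_seq ?enum_uniq// big_enum/= /pr.
rewrite (eq_bigr (fun t => (law t)%:E)) ?sumEFin// => t _.
by rewrite /law /pE fineK ?fin_num_measure.
Qed.

Lemma law_ge0 t : 0 <= law t.
Proof. exact: fine_ge0. Qed.

Lemma law_sum1 : \sum_t law t = 1.
Proof.
have := pr_law predT; rewrite /pr => ->.
by rewrite /pE (_ : [set w | _] = setT) ?probability_setT//; exact/seteqP.
Qed.

Variable beta : R.
Hypothesis betaE : forall i, (1 <= i)%N -> P (X i @^-1` B) = beta%:E.

Lemma law_mean i : (i < N)%N -> pr law [pred t | bit t i] = beta.
Proof.
move=> iN; rewrite pr_law /pE (_ : [set w | _] = X i.+1 @^-1` B) ?betaE//.
by apply/seteqP; split => w /=; rewrite bit_bits// inE.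
Qed.

Lemma sigmaX_preimage (I : set nat) i : I i -> sigmaX X I (X i @^-1` B).
Proof. by move=> Ii; apply: sub_sigma_algebra; exists i; split => //; exists B. Qed.

Variable rho : nat -> R.
Hypothesis rho_ge : forall g, phi_mix P X g <= rho g.

(** For i = j the left side is [beta], and [1 <= rho 0] suffices; for i < j, phi-mixing with gap j -
    i is applied to the events on X_(i+1) and X_(j+1). *)
Lemma law_cov i j : 1 <= rho 0%N -> (i < N)%N -> (j < N)%N ->
  pr law [pred t | bit t i && bit t j] <= beta * (beta + rho ((i - j) + (j - i))%N).
Proof.
move=> rho0; wlog ij : i j / (i <= j)%N => [hw iN jN|iN jN].
  have [ij|/ltnW ji] := leqP i j; first exact: hw.
  have := hw _ _ ji jN iN; rewrite addnC; apply: le_trans.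
  by rewrite le_eqVlt; apply/orP; left; apply/eqP; apply: eq_bigl => t /=; rewrite andbC.
have b0 : 0 <= beta.
  by rewrite -(law_mean iN); apply: sumr_ge0 => t _; exact: law_ge0.
have -> : (i - j + (j - i) = j - i)%N by lia.
have [->|nij] := eqVneq i j.
  rewrite subnn; have -> : pr law [pred t | bit t j && bit t j] = beta.
    by rewrite -(law_mean jN); apply: eq_bigl => t /=; rewrite andbb.
  by rewrite ler_peMr//; lra.
rewrite pr_law.
have -> : [set w | [pred t | bit t i && bit t j] (bits w)] =
    X i.+1 @^-1` B `&` X j.+1 @^-1` B.
  apply/seteqP; split => w /=; rewrite !bit_bits//.
    by move=> /andP[]; rewrite !inE.
  by move=> [? ?]; rewrite !mem_set.
have bE k : pE (X k.+1 @^-1` B) = beta by rewrite /pE betaE.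
apply: le_trans (@mixing_event_le i.+1 (j - i) _ _ _ _ _) _ => //.
- by apply: sigmaX_preimage => /=; lia.
- by apply: sigmaX_preimage => /=; lia.
- by rewrite !bE; apply: ler_wpM2l => //; rewrite lerD2l.
Qed.

Lemma law_mix (q k : nat) (a : N.-tuple bool) (E : pred (N.-tuple bool)) :
  pr law [pred t | (restr (fun i => (i < k)%N) t == a) &&
                  E (restr (fun i => (k + q <= i)%N) t)] <=
  pr law [pred t | restr (fun i => (i < k)%N) t == a] *
  (pr law [pred t | E (restr (fun i => (k + q <= i)%N) t)] + rho q).
Proof.
rewrite !pr_law.
pose A2 := [set w | restr (fun i => (i < k)%N) (bits w) == a].
pose A3 := [set w | E (restr (fun i => (k + q <= i)%N) (bits w))].
have -> : [set w | [pred t | (restr (fun i => (i < k)%N) t == a) &&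
   E (restr (fun i => (k + q <= i)%N) t)] (bits w)] = A2 `&` A3.
  by apply/seteqP; split => w /= /andP.
change (pE (A2 `&` A3) <= pE A2 * (pE A3 + rho q)).
have rhoq : 0 <= rho q.
  apply: le_trans (rho_ge q); have /andP[+ _] := @phi_sigma_le_mix 1 q isT.
  apply: le_trans.
  have P1 : (0 < P setT)%E by rewrite probability_setT.
  have /andP[+ _] := @phi_sigma_ub 1 q setT setT isT (@sigmaX_setT _) (@sigmaX_setT _) P1.
  exact: le_trans.
have mA2 : measurable A2 := measurable_bits [pred t | restr (fun i => (i < k)%N) t == a].
have mA3 : measurable A3 := measurable_bits [pred t | E (restr (fun i => (k + q <= i)%N) t)].
(* [phi_mix] takes pasts of at least one variable. For k = 0 the restricted tuple is constant, so
   [A2] is the whole space or empty. *)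
case: k => [|k] in A2 A3 mA2 mA3 *.
  have [rE|rE] := eqVneq a (restr (fun i => (i < 0)%N) a).
    have A2T : A2 = setT.
      apply/seteqP; split => // w _; rewrite /A2/=; apply/eqP; rewrite rE.
      by apply: eq_from_tnth => i; rewrite !tnth_mktuple.
    by rewrite A2T setTI /pE probability_setT/= mul1r lerDl.
  have A20 : A2 = set0.
    apply/seteqP; split => // w /= /eqP h; move: rE; rewrite -h => /eqP; apply.
    by apply: eq_from_tnth => i; rewrite !tnth_mktuple.
  by rewrite A20 set0I /pE measure0 mul0r.
apply: le_trans (@mixing_event_le k.+1 q _ _ _ _ _) _ => //.
- by apply: (@sigmaX_restr _ (fun i => (i < k.+1)%N) (pred1 a)) => i /=; lia.
- by apply: (@sigmaX_restr _ (fun i => (k.+1 + q <= i)%N) E) => i /=; lia.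
- apply: ler_wpM2l; first by have /andP[] := fine_prob_le1 mA2.
  by rewrite lerD2l.
Qed.

End mixing.

(** Telescoping: C / g^3 is at most 2C (1/g - 1/(g + 1)) for g >= 1. This serves for the mixing
    coefficients and for the Borel-Cantelli series. *)
Lemma sum_cubic_tail_le (R : realType) (rho : nat -> R) (C : R) (N : nat) :
  0 <= C -> (forall k, (k <= N)%N -> rho k <= 1) ->
  (forall k, (N < k)%N -> rho k <= C / k%:R ^+ 3) ->
  forall m, \sum_(0 <= k < m) rho k <= N.+1%:R + 2 * C.
Proof.
move=> C0 rho1 rhoC m.
have small j : (j <= N.+1)%N -> \sum_(0 <= k < j) rho k <= N.+1%:R.
  move=> jN; apply: (@le_trans _ _ (\sum_(0 <= k < j) 1)).
    by rewrite big_nat [leRHS]big_nat; apply: ler_sum => k /andP[_ kj]; apply: rho1; lia.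
  by rewrite big_const_nat subn0 iter_addr addr0 ler_nat.
have large j : \sum_(0 <= k < N.+1 + j) rho k <=
    N.+1%:R + 2 * C * (1 - (N.+1 + j)%:R^-1).
  elim: j => [|j IH].
    rewrite addn0; apply: le_trans (small _ (leqnn _)) _.
    rewrite lerDl; apply: mulr_ge0; first lra.
    by rewrite subr_ge0 invf_le1 ?ltr0n// ler1n.
  rewrite addnS big_nat_recr//=; apply: le_trans (lerD IH (rhoC _ _)) _; first lia.
  rewrite -addrA lerD2l.
  have : 1 <= (N.+1 + j)%:R :> R by rewrite ler1n.
  rewrite -[(N.+1 + j).+1%:R]natr1; move: (N.+1 + j)%:R => g g1.
  rewrite -lerBrDl.
  have -> : 2 * C * (1 - (g + 1)^-1) - 2 * C * (1 - g^-1) = C * (2 / (g * (g + 1))).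
    by field; lra.
  apply: ler_wpM2l => //; rewrite ler_pdivlMr; last by nra.
  rewrite mulrC ler_pdivrMr; last by rewrite exprn_gt0//; lra.
  have : 0 <= g * ((g - 1) * (2 * g + 1)) by do 2 (apply: mulr_ge0; first lra); lra.
  by lra.
have [mN|/ltnW Nm] := leqP m N.+1.
  by apply: le_trans (small _ mN) _; lra.
have := large (m - N.+1)%N; rewrite subnKC// => /le_trans; apply.
rewrite lerD2l ler_piMr//; first lra.
Qed.

(** * Exponential tail bound for centred counts of a mixing sequence *)

Section tail.
Context (d : measure_display) (T : measurableType d) (R : realType).
Variables (P : probability T R) (X : nat -> T -> R).
Hypothesis mX : forall i, (1 <= i)%N -> measurable_fun setT (X i).
Hypothesis phi_rate : exists C : R, exists N : nat, forall n, (N <= n)%N ->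
      phi_mix P X n <= C / (n%:R ^+ 3).

Lemma phi_majorant : exists (rho : nat -> R) (C S : R) (N : nat),
  [/\ forall g, phi_mix P X g <= rho g, 1 <= rho 0%N, forall k, 0 <= rho k,
      forall m, \sum_(0 <= k < m) rho k <= S &
      0 <= C /\ forall g, (N <= g)%N -> rho g <= C / g%:R ^+ 3].
Proof.
have [C [N CN]] := phi_rate.
pose rho g : R := if (g <= N)%N then 1 else `|C| / g%:R ^+ 3.
exists rho, `|C|, (N.+1%:R + 2 * `|C|), N.+1; split => //.
- move=> g; rewrite /rho; case: leqP => gN.
    by have /andP[_ ->] := phi_sigma_le_mix P mX g (leqnn 1).
  apply: le_trans (CN _ (ltnW gN)) _; apply: ler_wpM2r; last exact: ler_norm.
  by rewrite invr_ge0 exprn_ge0.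
- by move=> k; rewrite /rho; case: leqP => // _; rewrite divr_ge0// exprn_ge0.
- by apply: sum_cubic_tail_le => // k; rewrite /rho; [move=> ->|rewrite ltnNge => /negbTE ->].
- by split => // g; rewrite ltnNge /rho => /negbTE ->.
Qed.

Definition dev (B : set R) (beta : R) (n : nat) (w : T) : R :=
  \sum_(1 <= i < n.+1) ((X i w \in B)%:R - beta).

Lemma dev_tail : exists K : R, 0 < K /\ exists Q : nat,
  forall (q n : nat) (B : set R) (beta t lam : R),
  (Q <= q)%N -> (0 < q)%N -> (n <= 16 * q ^ 4)%N -> measurable B ->
  (forall i, (1 <= i)%N -> P (X i @^-1` B) = beta%:E) ->
  0 <= t -> 2 * t * q%:R <= 1 ->
  measurable [set w | lam <= `|dev B beta n w|] /\
  fine (P [set w | lam <= `|dev B beta n w|]) <=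
    2 * expR (K + K * t ^+ 2 * q%:R ^+ 4 * beta - t * lam).
Proof.
have [rho [C [S [Q [phi_le rho1 rho0 rhoS [C0 rhoC]]]]]] := phi_majorant.
have S0 : 0 <= S by have := rhoS 0%N; rewrite big_geq.
(* Each of the 8 q^3 double blocks contributes 16 S t^2 q beta and 4 C / q^3; the summand 1 makes
   the constant positive. *)
exists (128 * S + 32 * C + 1); split; first lra.
exists Q => q n B beta t lam Qq q0 nq mB betaE t0 tq.
pose N := (16 * q ^ 4)%N.
(* Weights vanishing from n on pad the sum to [N] terms without changing it. *)
pose c i : R := (i < n)%:R.
pose mu := @law _ _ _ P X B N.
pose Z (b : N.-tuple bool) := \sum_(0 <= i < N) c i * ((bit b i)%:R - beta).
have beta01 : 0 <= beta <= 1.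
  have mXB : measurable (X 1%N @^-1` B) by rewrite -[_ @^-1` _]setTI; exact: mX.
  by have := fine_prob_le1 P mXB; rewrite betaE.
have c01 i : 0 <= c i <= 1 by rewrite /c; case: (i < n)%N => /=; rewrite ?lexx ?ler01.
have devE w : dev B beta n w = Z (bits X B N w).
  rewrite /dev /Z big_add1/= [RHS](@big_cat_nat _ _ _ n)//= [X in _ = _ + X]big_nat_cond.
  rewrite [X in _ = _ + X]big1 ?addr0; last first.
    by move=> i /andP[/andP[ni _] _]; rewrite /c ltnNge ni mul0r.
  by apply: eq_big_nat => i /andP[_ ni]; rewrite /c ni mul1r bit_bits//; exact: leq_trans nq.
have -> : [set w | lam <= `|dev B beta n w|] =
    [set w | [pred b | lam <= `|Z b|] (bits X B N w)].
  by apply/seteqP; split => w /=; rewrite devE.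
split; first exact: measurable_bits.
rewrite -(@pr_law _ _ _ P X mX B N mB).
have mgf (s : R) : `|s| = t -> ex mu (fun b => expR (s * Z b)) <=
    expR (128 * S * t ^+ 2 * q%:R ^+ 4 * beta + 32 * C).
  move=> st; have NE : N = (2 * q * (8 * q ^ 3))%N by rewrite /N (expnS q 3); lia.
  have qR : (0 : R) < q%:R by rewrite ltr0n.
  have h := @ex_exp_sum R N mu (@law_ge0 _ _ _ P X B N) (@law_sum1 _ _ _ P X mX B N mB) c beta c01 beta01 q
    rho S rho0 rhoS (@law_mean _ _ _ P X mX B N mB beta betaE)
    (fun i j => @law_cov _ _ _ P X mX B N mB beta betaE rho phi_le i j rho1)
    (C / q%:R ^+ 3).
  apply: le_trans (h _ _ s (8 * q ^ 3)%N NE _) _; last 1 first.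
  - rewrite ler_expR -[s ^+ 2]real_normK ?num_real// st natrM natrX le_eqVlt.
    apply/orP; left; apply/eqP; field; lra.
  - by rewrite divr_ge0// exprn_ge0// ltW.
  - move=> k a E.
    apply: le_trans (@law_mix _ _ _ P X mX B N mB rho phi_le q k a E) _.
    by apply: ler_wpM2l; [apply: sumr_ge0 => ? _; exact: law_ge0|rewrite lerD2l rhoC].
  - by rewrite st.
have := @ex_markov R _ mu (@law_ge0 _ _ _ P X B N)
  (fun b => expR (t * Z b) + expR (- t * Z b)) [pred b | lam <= `|Z b|] (expR (t * lam))
  (expR_gt0 _).
have -> : ex mu (fun b => expR (t * Z b) + expR (- t * Z b)) =
   ex mu (fun b => expR (t * Z b)) + ex mu (fun b => expR (- t * Z b)).
  by rewrite /ex -big_split/=; apply: eq_bigr => b _; rewrite mulrDr.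
move=> h; apply: le_trans (h _ _) _.
- by move=> b; rewrite addr_ge0 ?expR_ge0.
- move=> b /= lb; have e1 := expR_gt0 (t * Z b); have e2 := expR_gt0 (- t * Z b).
  have le : expR (t * lam) <= expR (t * `|Z b|) by rewrite ler_expR ler_wpM2l.
  apply: le_trans le _.
  by case: (ger0P (Z b)) => _; rewrite ?mulrN -?mulNr; lra.
have h1 := mgf t (ger0_norm t0).
have h2 := mgf (- t) (etrans (normrN t) (ger0_norm t0)).
rewrite ler_pdivrMr ?expR_gt0// -[leRHS]mulrA -expRD subrK.
set E := expR (_ + 32 * C) in h1 h2.
apply: (@le_trans _ _ (2 * E)); first by lra.
rewrite ler_pM2l// /E ler_expR.
case/andP: beta01 => b0 _.
have [y yE] : exists y : R, y = t ^+ 2 * q%:R ^+ 4 * beta by eexists.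
have y0 : 0 <= y by rewrite yE mulr_ge0// mulr_ge0 ?sqr_ge0// exprn_ge0.
have -> : 128 * S * t ^+ 2 * q%:R ^+ 4 * beta = 128 * S * y by rewrite yE; ring.
have -> : (128 * S + 32 * C + 1) * t ^+ 2 * q%:R ^+ 4 * beta =
  (128 * S + 32 * C + 1) * y by rewrite yE; ring.
have := mulr_ge0 C0 y0; lra.
Qed.

End tail.

(** * Almost sure bounds *)

Lemma fourth_root_exists (n : nat) : exists q : nat, (q ^ 4 <= n < q.+1 ^ 4)%N.
Proof.
elim: n => [|n [q /andP[qn nq]]]; first by exists 0%N.
have [h|h] := leqP (q.+1 ^ 4) n.+1; last by exists q; rewrite h andbT; lia.
exists q.+1; rewrite h /=; apply: leq_ltn_trans nq _.
by rewrite ltn_exp2r.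
Qed.

(** The integer part of n^(1/4), used as block length. *)
Definition root4 (n : nat) : nat := projT1 (cid (fourth_root_exists n)).

Lemma root4P n : ((root4 n) ^ 4 <= n < (root4 n).+1 ^ 4)%N.
Proof. by rewrite /root4; case: cid. Qed.

Lemma root4_large (Q n : nat) : (Q ^ 4 <= n)%N -> (Q <= root4 n)%N.
Proof.
move=> Qn; have /andP[_ h] := root4P n.
by have := leq_ltn_trans Qn h; rewrite ltn_exp2r.
Qed.

(** The inequality q + 1 <= 2q raised to the fourth power. *)
Lemma root4_ub n : (0 < n)%N -> (n <= 16 * (root4 n) ^ 4)%N.
Proof.
move=> n0; have /andP[_ h] := root4P n.
have q1 : (1 <= root4 n)%N by apply: root4_large; rewrite exp1n.
apply: (leq_trans (ltnW h)); rewrite -[16%N]/(2 ^ 4)%N -expnMn.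
by rewrite leq_exp2r//; lia.
Qed.

(** Let q be the integer root and r = sqrt (q + 1). Then n < r^8, so ln n <= 8 ln r <= 8r, and for C
    >= 0, 8Cr <= r^2 - 1 = q as soon as r >= 8C + 1. *)
Lemma ln_root4_small (R : realType) (C : R) :
  exists N : nat, forall n, (N <= n)%N -> C * ln (n%:R : R) <= (root4 n)%:R.
Proof.
wlog C0 : C / 0 <= C => [hw|].
  have [N hN] := hw `|C| (normr_ge0 _); exists N.+1 => n Nn.
  apply: le_trans (hN n (ltnW Nn)); apply: ler_wpM2r; last exact: ler_norm.
  by apply: ln_ge0; rewrite ler1n; lia.
pose Q := (Num.truncn ((8 * C + 1) ^+ 2)).+1.
exists (Q ^ 4)%N.+1 => n Nn.
have Qq : (Q <= root4 n)%N by apply: root4_large; lia.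
have /andP[_ nq] := root4P n.
have n0 : (0 : R) < n%:R by rewrite ltr0n; lia.
pose r : R := Num.sqrt (root4 n).+1%:R.
have r2 : r ^+ 2 = (root4 n)%:R + 1 by rewrite sqr_sqrtr// natr1.
have r0 : 0 < r by rewrite sqrtr_gt0 ltr0n.
have lnn : ln (n%:R : R) <= 8 * r.
  apply: (@le_trans _ _ (ln (r ^+ 8))).
    rewrite ler_ln ?posrE ?exprn_gt0//.
    have -> : r ^+ 8 = ((root4 n).+1 ^ 4)%N%:R.
      by rewrite natrX -natr1 -r2 -exprM.
    by rewrite ler_nat ltnW.
  rewrite lnXn// -[leLHS]mulr_natl; apply: ler_wpM2l => //.
  exact/ltW/ln_sublinear.
apply: le_trans (ler_wpM2l C0 lnn) _.
have rC : 8 * C + 1 <= r.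
  rewrite -[leLHS]ger0_norm; last lra.
  rewrite -sqrtr_sqr ler_sqrt; last by rewrite ler0n.
  apply: (@le_trans _ _ Q%:R); last by rewrite ler_nat; lia.
  by rewrite /Q; apply/ltW/Num.Theory.truncnS_gt.
have -> : (root4 n)%:R = r ^+ 2 - 1 by rewrite r2 addrK.
by nra.
Qed.

Lemma fine_prob_bigsetU_le (d : measure_display) (T : measurableType d) (R : realType)
    (P : probability T R) (A : nat -> set T) (c : R) (n : nat) :
  (forall j, (j < n)%N -> measurable (A j) /\ fine (P (A j)) <= c) ->
  measurable (\big[setU/set0]_(j < n) A j) /\
  fine (P (\big[setU/set0]_(j < n) A j)) <= n%:R * c.
Proof.
elim: n => [|n IH] H; first by rewrite big_ord0 measure0 mul0r.
have [mU PU] := IH (fun j jn => H j (ltnW jn)).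
have [mA PA] := H n (ltnSn n).
rewrite big_ord_recr/=; split; first exact: measurableU.
apply: (@le_trans _ _ (fine (P (\big[setU/set0]_(j < n) A j)) + fine (P (A n)))).
  rewrite -fineD ?fin_num_measure// fine_le ?fin_numD ?fin_num_measure//; last exact: measureU2.
  exact: measurableU.
by rewrite -natr1 mulrDl mul1r lerD.
Qed.

Lemma borel_cantelli_cubic (d : measure_display) (T : measurableType d) (R : realType)
    (P : probability T R) (A : nat -> set T) (C : R) (N : nat) :
  (forall n, (N <= n)%N -> measurable (A n) /\ fine (P (A n)) <= C / n%:R ^+ 3) ->
  {ae P, forall w, exists M : nat, forall n, (M <= n)%N -> ~ A n w}.
Proof.
move=> H.
(* Emptying the first events does not change the superior limit and brings the whole series under
   the cubic bound. *)
pose G n := if (n <= N)%N then set0 else A n.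
have mG n : measurable (G n).
  by rewrite /G; case: leqP => // /ltnW /H[].
have C0 : 0 <= C.
  have [mA h] := H _ (leqnSn N).
  have : 0 <= C / N.+1%:R ^+ 3 by apply: le_trans h; exact: fine_ge0.
  by rewrite pmulr_lge0// invr_gt0 exprn_gt0// ltr0n.
have sG m : \sum_(0 <= k < m) fine (P (G k)) <= N.+1%:R + 2 * C.
  apply: sum_cubic_tail_le => // k; rewrite /G.
    by move=> ->; rewrite measure0.
  by rewrite ltnNge => /negbTE kN; rewrite kN; case: (H k) => //; lia.
have GE : (fun m => \sum_(0 <= k < m) P (G k))%E =
    (fun m => (\sum_(0 <= k < m) fine (P (G k)))%:E).
  apply/funext => m; rewrite -sumEFin; apply: eq_bigr => k _.
  by rewrite fineK// fin_num_measure.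
exists (lim_sup_set G); split.
- by apply: bigcap_measurable => // k _; exact: bigcup_measurable.
- apply: lim_sup_set_cvg0 => //.
  apply: (@le_lt_trans _ _ (N.+1%:R + 2 * C)%:E); last exact: ltry.
  apply: lime_le; first exact: is_cvg_nneseries.
  by apply: nearW => m; have := congr1 (@^~ m) GE => /= ->; rewrite lee_fin.
- move=> w /= nw k _; apply: contrapT => nk; apply: nw; exists (maxn k N.+1) => n.
  rewrite geq_max => /andP[kn Nn] Aw; apply: nk; exists n => //.
  by rewrite /G leqNgt Nn.
Qed.

(** * Quantiles and distribution functions *)

Lemma quantile_between (R : realType) (G : R -> R) (p x y : R) :
  {homo G : a b / a <= b} -> p <= G x -> G y < p -> y <= quantile G p <= x.
Proof.
move=> mG px yp.
have lb : lbound [set x | p <= G x] y.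
  move=> z /= pz; rewrite leNgt; apply/negP => /ltW/mG h.
  by have := le_lt_trans (le_trans pz h) yp; rewrite ltxx.
apply/andP; split; first by apply: lb_le_inf => //; exists x.
by apply: ge_inf => //; exists y.
Qed.

Section distribution_function.
Context (d : measure_display) (T : measurableType d) (R : realType).
Variables (P : probability T R) (Y : T -> R) (F : R -> R).
Hypothesis mY : measurable_fun setT Y.
Hypothesis FE : forall x, P [set w | Y w <= x] = (F x)%:E.

Lemma sublevelE x : [set w | Y w <= x] = Y @^-1` `]-oo, x].
Proof. by apply/seteqP; split => w /=; rewrite in_itv. Qed.

Lemma measurable_sublevel x : measurable [set w | Y w <= x].
Proof.
by rewrite sublevelE -[_ @^-1` _]setTI; exact: mY.
Qed.

Lemma df_nondecreasing : {homo F : x y / x <= y}.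
Proof.
move=> x y xy; rewrite -lee_fin -!FE le_measure ?inE//; try exact: measurable_sublevel.
by move=> w /= /le_trans; apply.
Qed.

Lemma df_itv a b : a <= b -> P (Y @^-1` `]a, b]) = (F b - F a)%:E.
Proof.
move=> ab.
have -> : Y @^-1` `]a, b] = [set w | Y w <= b] `\` [set w | Y w <= a].
  apply/seteqP; split => w /=; rewrite in_itv/=.
    by move=> /andP[aw wb]; split => //; apply/negP; rewrite -ltNge.
  by move=> [wb /negP]; rewrite -ltNge wb andbT.
have -> : P ([set w | Y w <= b] `\` [set w | Y w <= a]) =
    (P [set w | (Y w <= b)%R] - P ([set w | (Y w <= b)%R] `&` [set w | (Y w <= a)%R]))%E.
  apply: measureD; try exact: measurable_sublevel.
  by apply: le_lt_trans (probability_le1 _ _) (ltry _); exact: measurable_sublevel.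
rewrite FE (_ : _ `&` _ = [set w | Y w <= a]) ?FE//.
by apply/seteqP; split => w /= => [[]//|wa]; split => //; exact: le_trans ab.
Qed.

(** The limits of a distribution function at both infinities. The set {p <= F} is thus nonempty and
    bounded below, and its real [inf] is a genuine infimum. *)
Lemma df_unbounded p : 0 < p < 1 -> (exists x, p <= F x) /\ (exists y, F y < p).
Proof.
move=> /andP[p0 p1].
pose Z : {RV P >-> R} := HB.pack Y (isMeasurableFun.Build _ _ _ _ Y mY).
have ZE x : cdf Z x = (F x)%:E.
  have -> : cdf Z x = P (Y @^-1` `]-oo, x]) by [].
  by rewrite -sublevelE FE.
split.
  have h : \forall x \near +oo%R, (p%:E < cdf Z x)%E.
    apply: (@cvg_cdfy1 _ _ _ P Z [set e | (p%:E < e)%E]).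
    by apply: open_nbhs_nbhs; split; [exact: open_ereal_gt_ereal|rewrite /= lte_fin].
  by have [x /=] := filter_ex h; rewrite ZE lte_fin => /ltW ?; exists x.
have h : \forall x \near -oo%R, (cdf Z x < p%:E)%E.
  apply: (@cvg_cdfNy0 _ _ _ P Z [set e | (e < p%:E)%E]).
  by apply: open_nbhs_nbhs; split; [exact: open_ereal_lt_ereal|rewrite /= lte_fin].
by have [x /=] := filter_ex h; rewrite ZE lte_fin => ?; exists x.
Qed.

Lemma df_quantile p : 0 < p < 1 -> {for quantile F p, continuous F} ->
  F (quantile F p) = p.
Proof.
move=> p01 cF; set xi := quantile F p in cF *.
have [[x0 px0] [y0 y0p]] := df_unbounded p01.
have lb : lbound [set x | p <= F x] y0.
  move=> z /= pz; rewrite leNgt; apply/negP => /ltW/df_nondecreasing h.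
  by have := le_lt_trans (le_trans pz h) y0p; rewrite ltxx.
have near_lt e : 0 < e -> exists2 r, 0 < r & forall z, `|xi - z| < r -> `|F xi - F z| < e.
  move=> e0; have /cvgrPdist_lt/(_ e e0)/nbhs_ballP[r /= r0 hr] := cF.
  by exists r => // z hz; apply: hr.
apply/eqP; rewrite eq_le; apply/andP; split; rewrite leNgt; apply/negP => h.
  (* If F xi > p, continuity puts xi - r/2 into {p <= F}, although xi is a lower bound of this
     set. *)
  have [r r0 hr] := near_lt (F xi - p) ltac:(by rewrite subr_gt0).
  have := hr (xi - r / 2) _; rewrite opprB addrCA subrr addr0 ger0_norm; last lra.
  have rr : r / 2 < r by lra.
  move=> /(_ rr) /ltr_normlW hF.
  have : xi <= xi - r / 2 by apply: ge_inf; [exists y0|rewrite /=; lra].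
  by lra.
(* If F xi < p, continuity and monotonicity keep F below p up to xi + r/2, which is then a lower
   bound above the infimum. *)
have [r r0 hr] := near_lt (p - F xi) ltac:(by rewrite subr_gt0).
suff : xi + r / 2 <= xi by lra.
apply: lb_le_inf; first by exists x0.
move=> z /= pz; rewrite leNgt; apply/negP => zr.
have := hr (xi + r / 2) _; rewrite opprD addrA subrr add0r normrN ger0_norm; last lra.
have rr : r / 2 < r by lra.
move=> /(_ rr); rewrite distrC => /ltr_normlW hF.
by have := df_nondecreasing (ltW zr); lra.
Qed.

End distribution_function.

(** * Expansion of F near the quantile *)

Section taylor.
Variables (R : realType) (xi delta : R).
Let window (x : R) := xi - delta < x < xi + delta.

Lemma MVT_window (g dg : R -> R) (a b : R) :
  (forall x, window x -> is_derive x 1 g (dg x)) -> window a -> window b -> a <= b ->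
  exists c, [/\ a <= c, c <= b & g b - g a = dg c * (b - a)].
Proof.
move=> Hg /andP[wa _] /andP[_ wb] ab.
have w x : x \in `[a, b]%R -> window x.
  by rewrite in_itv/= => /andP[? ?]; apply/andP; split; lra.
have [||c cab gE] := @MVT_segment R g dg a b ab.
- by move=> x xab; apply/Hg/w; apply: subset_itv_oo_cc xab.
- apply: derivable_within_continuous => x xab.
  by have /@ex_derive := Hg x (w x xab).
by move: cab; rewrite in_itv/= => /andP[? ?]; exists c.
Qed.

(** The mean value theorem is applied to F and then to f, which gives M h^2 without the factor
    1/2. *)
Lemma taylor2_window (F f : R -> R) (M h : R) :
  (forall x, window x -> is_derive x 1 F (f x)) ->
  (forall x, window x -> derivable f x 1) ->
  (forall x, window x -> `|derive1 f x| <= M) -> `|h| < delta ->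
  `|F (xi + h) - F xi - f xi * h| <= M * h ^+ 2.
Proof.
move=> dF df fM hd.
have df' x : window x -> is_derive x 1 f (derive1 f x).
  by move=> /df/derivableP; rewrite derive1E.
have hd2 := hd; move: hd2; rewrite ltr_norml => /andP[h1 h2].
have wxi : window xi by apply/andP; split; lra.
have wh : window (xi + h) by apply/andP; split; lra.
have M0 : 0 <= M by apply: le_trans (fM _ wxi).
have sq : `|h| * `|h| = h ^+ 2 by rewrite -expr2 real_normK ?num_real.
(* [c] is the displacement from xi of the intermediate point for F, and [e] the intermediate point
   for f. *)
suff [c [e [we ce FE]]] : exists c e, [/\ window e, `|c| <= `|h| &
    F (xi + h) - F xi - f xi * h = derive1 f e * c * h].
  rewrite FE !normrM -sq mulrA; apply: ler_wpM2r => //.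
  by apply: ler_pM => //; exact: fM.
have [h0|h0] := leP 0 h.
  have [|c [c1 c2 FE]] := MVT_window dF wxi wh; first lra.
  have wc : window c by apply/andP; split; lra.
  have [e [e1 e2 fE]] := MVT_window df' wxi wc c1.
  exists (c - xi), e; split; first by apply/andP; split; lra.
    by rewrite !ger0_norm//; lra.
  by rewrite FE -fE; ring.
have [|c [c1 c2 FE]] := MVT_window dF wh wxi; first lra.
have wc : window c by apply/andP; split; lra.
have [e [e1 e2 fE]] := MVT_window df' wc wxi c2.
exists (c - xi), e; split; first by apply/andP; split; lra.
  by rewrite ler0_norm ?ler0_norm//; lra.
have -> : derive1 f e * (c - xi) * h = - (f xi - f c) * h by rewrite fE; ring.
have -> : F (xi + h) = F xi - f c * (xi - (xi + h)) by rewrite -FE; ring.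
by ring.
Qed.

Lemma df_lipschitz_window (F f : R -> R) (M a b : R) :
  (forall x, window x -> is_derive x 1 F (f x)) ->
  (forall x, window x -> f x <= M) -> window a -> window b -> a <= b ->
  F b - F a <= M * (b - a).
Proof.
move=> dF fM wa wb ab; have [c [c1 c2 ->]] := MVT_window dF wa wb ab.
apply: ler_wpM2r; first lra.
by move: wa wb => /andP[? ?] /andP[? ?]; apply: fM; apply/andP; split; lra.
Qed.

End taylor.

Lemma expR_neg_ln (R : realType) (k n : nat) : (0 < n)%N ->
  expR (- (k%:R * ln (n%:R : R))) = (n%:R ^+ k)^-1.
Proof. by move=> n0; rewrite expRN expRM_natl lnK// posrE ltr0n. Qed.

(** * Almost sure deviations, for one fixed set and for families of small sets *)

Section almost_sure.
Context (d : measure_display) (T : measurableType d) (R : realType).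
Variables (P : probability T R) (X : nat -> T -> R).
Hypothesis mX : forall i, (1 <= i)%N -> measurable_fun setT (X i).
Hypothesis phi_rate : exists C : R, exists N : nat, forall n, (N <= n)%N ->
      phi_mix P X n <= C / (n%:R ^+ 3).
Let q (n : nat) : R := (root4 n)%:R.
Let L (n : nat) : R := ln n%:R.

Lemma ae_dev_global (B : set R) (beta : R) : measurable B -> beta <= 1 ->
  (forall i, (1 <= i)%N -> P (X i @^-1` B) = beta%:E) ->
  {ae P, forall w, exists N : nat, forall n, (N <= n)%N ->
     `|dev X B beta n w| <= 6 * q n ^+ 2 * L n}.
Proof.
move=> mB b1 betaE.
have [K [K0 [Q HK]]] := dev_tail mX phi_rate.
suff : {ae P, forall w, exists N : nat, forall n, (N <= n)%N ->
    ~ [set w | 6 * q n ^+ 2 * L n <= `|dev X B beta n w|] w}.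
  apply: filterS => w [N HN]; exists N => n Nn.
  by have /negP := HN n Nn; rewrite -ltNge => /ltW.
apply: (@borel_cantelli_cubic _ _ _ _ _ (2 * expR (2 * K)) (Q ^ 4).+1) => n Nn.
have q1 : (0 < root4 n)%N by apply: root4_large; rewrite exp1n; lia.
have q0 : 1 <= q n by rewrite /q ler1n.
(* For t = 1/(2q^2) the variance term is K beta / 4, which is bounded, and t lam = 3 ln n yields
   n^-3. *)
have [||||mA PA] := HK (root4 n) n B beta (1 / (2 * q n ^+ 2)) (6 * q n ^+ 2 * L n)
  _ q1 _ mB betaE.
- by apply: root4_large; lia.
- by apply: root4_ub; lia.
- by rewrite divr_ge0// mulr_ge0// exprn_ge0//; lra.
- rewrite -/(q n); have -> : 2 * (1 / (2 * q n ^+ 2)) * q n = (q n)^-1 by field; lra.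
  by rewrite invf_le1//; lra.
split => //; apply: le_trans PA _; rewrite -/(q n) -[leRHS]mulrA; apply: ler_wpM2l => //.
rewrite -expR_neg_ln; last lia.
rewrite -expRD ler_expR.
have -> : 1 / (2 * q n ^+ 2) * (6 * q n ^+ 2 * L n) = 3 * L n by field; lra.
have -> : K * (1 / (2 * q n ^+ 2)) ^+ 2 * q n ^+ 4 * beta = K * beta / 4 by field; lra.
have : K * beta <= K by rewrite ger_pMr.
by rewrite /L; lra.
Qed.

Lemma ae_dev_local (B : nat -> nat -> set R) (beta : nat -> nat -> R)
    (J : nat -> nat -> Prop) (b : R) (N0 : nat) : 0 <= b ->
  (forall n j, measurable (B n j)) ->
  (forall n j i, (1 <= i)%N -> P (X i @^-1` B n j) = (beta n j)%:E) ->
  (forall n j, (N0 <= n)%N -> J n j -> beta n j <= b * L n / q n ^+ 2) ->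
  exists2 K2 : R, 0 <= K2 & {ae P, forall w, exists N : nat, forall n, (N <= n)%N ->
     forall j, (j <= n)%N -> J n j ->
     `|dev X (B n j) (beta n j) n w| <= K2 * L n * q n}.
Proof.
move=> b0 mB betaE betab.
have [K [K0 [Q HK]]] := dev_tail mX phi_rate.
(* For t = 1/(2q), t lam = K2 L / 2 = 4L + K b L / 4: the second summand absorbs the variance term K
   q^2 beta / 4, the first leaves n^-4. *)
pose K2 := 8 + K * b / 2.
have K20 : 0 <= K2 by rewrite /K2; have := mulr_ge0 (ltW K0) b0; lra.
exists K2 => //.
pose A n j := [set w | J n j /\ K2 * L n * q n <= `|dev X (B n j) (beta n j) n w|].
suff : {ae P, forall w, exists N : nat, forall n, (N <= n)%N ->
    ~ (\big[setU/set0]_(j < n.+1) A n j) w}.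
  apply: filterS => w [N HN]; exists N => n Nn j jn Jj.
  rewrite leNgt; apply/negP => /ltW h; apply: (HN n Nn).
  by rewrite -bigcup_mkord; exists j.
apply: (@borel_cantelli_cubic _ _ _ _ _ (4 * expR K) (maxn (Q ^ 4) N0).+1) => n Nn.
have q1 : (0 < root4 n)%N by apply: root4_large; rewrite exp1n; lia.
have q0 : 1 <= q n by rewrite /q ler1n.
have n1 : 1 <= n%:R :> R by rewrite ler1n; lia.
have [|mU PU] := @fine_prob_bigsetU_le _ _ _ P (A n) (2 * expR K / n%:R ^+ 4) n.+1.
  move=> j _.
  have [Jj|nJ] := pselect (J n j); last first.
    rewrite (_ : A n j = set0); last by apply/seteqP; split => w //= [].
    split; first exact: measurable0.
    by rewrite measure0 /= divr_ge0 ?exprn_ge0// mulr_ge0// expR_ge0.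
  have -> : A n j = [set w | K2 * L n * q n <= `|dev X (B n j) (beta n j) n w|].
    by apply/seteqP; split => w //= [].
  have [||||mA PA] := HK (root4 n) n (B n j) (beta n j) (1 / (2 * q n)) (K2 * L n * q n)
    _ q1 _ (mB n j) (betaE n j).
  - by apply: root4_large; lia.
  - by apply: root4_ub; lia.
  - by rewrite divr_ge0//; lra.
  - by rewrite -/(q n) le_eqVlt; apply/orP; left; apply/eqP; field; lra.
  split => //; apply: le_trans PA _; rewrite -/(q n) -[leRHS]mulrA; apply: ler_wpM2l => //.
  rewrite -expR_neg_ln; last lia.
  rewrite -expRD ler_expR -addrA lerD2l.
  have -> : 1 / (2 * q n) * (K2 * L n * q n) = K2 * L n / 2 by field; lra.
  have -> : K * (1 / (2 * q n)) ^+ 2 * q n ^+ 4 * beta n j =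
      K / 4 * (q n ^+ 2 * beta n j) by field; lra.
  have qb : q n ^+ 2 * beta n j <= b * L n.
    rewrite mulrC -ler_pdivlMr; last by rewrite exprn_gt0//; lra.
    by apply: betab => //; lia.
  have : K / 4 * (q n ^+ 2 * beta n j) <= K / 4 * (b * L n) by apply: ler_wpM2l => //; lra.
  by rewrite /K2 /L; lra.
split => //; apply: le_trans PU _.
(* The union has n + 1 <= 2n events, which costs one power of n and leaves the summable n^-3. *)
have -> : 4 * expR K / n%:R ^+ 3 = (2 * n%:R) * (2 * expR K / n%:R ^+ 4) :> R.
  by field; lra.
apply: ler_wpM2r; last by rewrite -natr1; lra.
by rewrite divr_ge0 ?exprn_ge0// mulr_ge0// expR_ge0.
Qed.

End almost_sure.

(** * Localization of the empirical quantile *)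

Section empirical.
Context (d : measure_display) (T : measurableType d) (R : realType).
Variables (X : nat -> T -> R) (n : nat) (w : T).

Lemma emp_df_nondecreasing : {homo emp_df X n w : x y / x <= y}.
Proof.
move=> x y xy; rewrite /emp_df; apply: ler_wpM2l => //.
apply: ler_sum => i _; rewrite ler_nat.
by case: (leP (X i w) x) => // /le_trans -> .
Qed.

Hypothesis n0 : (0 < n)%N.

Lemma mean_sub_dev (B : set R) (beta : R) :
  n%:R^-1 * \sum_(1 <= i < n.+1) (X i w \in B)%:R - beta = n%:R^-1 * dev X B beta n w.
Proof.
rewrite /dev sumrB mulrBr; congr (_ - _).
rewrite big_const_nat subSS subn0 iter_addr addr0 -[beta *+ n]mulr_natl mulKf//.
by rewrite pnatr_eq0; lia.
Qed.

Lemma emp_df_dev x beta :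
  emp_df X n w x - beta = n%:R^-1 * dev X `]-oo, x] beta n w.
Proof.
rewrite -mean_sub_dev /emp_df; congr (_ * _ - _).
by apply: eq_bigr => i _; rewrite mem_setE in_itv.
Qed.

Lemma emp_df_dev_itv a b beta : a <= b ->
  emp_df X n w b - emp_df X n w a - beta = n%:R^-1 * dev X `]a, b] beta n w.
Proof.
move=> ab; rewrite -mean_sub_dev /emp_df -mulrBr -sumrB; congr (_ * _ - _).
apply: eq_bigr => i _; rewrite mem_setE in_itv/=.
case: (leP (X i w) a) => [Xa|aX] /=; last by rewrite subr0.
by rewrite (le_trans Xa ab) subrr.
Qed.

End empirical.

Lemma bahadur_of_increments (R : realType) (G : R -> R) (xi p fx q L K3 : R) :
  {homo G : x y / x <= y} -> 0 < fx -> 1 <= L -> 1 <= q -> 0 <= K3 ->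
  K3 / fx + 1 <= q -> `|G xi - p| <= 6 * L / q ^+ 2 ->
  (forall j : int, `|j%:~R| <= (6 / fx + 2) * L * q ->
     `|G (xi + j%:~R / q ^+ 3) - G xi - fx * (j%:~R / q ^+ 3)| <= K3 * L / q ^+ 3) ->
  `|quantile G p - (xi - (G xi - p) / fx)| <= (K3 / fx + 2) * L / q ^+ 3.
Proof.
move=> mG fx0 L1 q1 K30 Kq; set D := G xi - p => hD hG.
have q30 : 0 < q ^+ 3 by rewrite exprn_gt0//; lra.
(* [K3 / fx] compensates the error of the increments; the extra 1 absorbs the rounding to the grid
   on the right and gives the strict inequality on the left. *)
have [K KE] : exists K : R, K = K3 / fx + 1 by eexists.
have fK : fx * K = K3 + fx by rewrite KE; field; lra.
have K0 : 0 <= K by rewrite KE; have := divr_ge0 K30 (ltW fx0); lra.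
have [u uE] : exists u : R, u = (q ^+ 3)^-1 by eexists.
have u0 : 0 < u by rewrite uE invr_gt0.
(* [v] is rounded down to the grid. The index found is at most 6 L q / fx + K L + 1 in absolute
   value, and K L and 1 are each at most L q: hence the constant [6 / fx + 2]. *)
have grid v : `|v| <= 6 / fx * L / q ^+ 2 + K * L * u ->
    exists h, [/\ v - u <= h, h <= v & `|G (xi + h) - G xi - fx * h| <= K3 * L * u].
  move=> hv; pose j := Num.floor (q ^+ 3 * v).
  have j1 : j%:~R <= q ^+ 3 * v by exact: floor_le.
  have j2 : q ^+ 3 * v < j%:~R + 1 by have := floorD1_gt (q ^+ 3 * v); rewrite intrD.
  have jv : `|j%:~R - q ^+ 3 * v| <= 1 by rewrite ler_norml; lra.
  have qv : `|q ^+ 3 * v| <= 6 / fx * L * q + K * L.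
    rewrite normrM (ger0_norm (ltW q30)).
    apply: le_trans (ler_wpM2l (ltW q30) hv) _.
    by rewrite uE le_eqVlt; apply/orP; left; apply/eqP; field; lra.
  have jb : `|j%:~R| <= (6 / fx + 2) * L * q :> R.
    have := ler_normD (j%:~R - q ^+ 3 * v) (q ^+ 3 * v); rewrite subrK.
    have : K * L <= q * L by apply: ler_wpM2r; lra.
    have : 1 <= q * L by rewrite -[leLHS]mulr1; apply: ler_pM.
    have -> : (6 / fx + 2) * L * q = 6 / fx * L * q + 2 * (q * L) by ring.
    by lra.
  exists (j%:~R / q ^+ 3); split.
  - rewrite uE ler_pdivlMr// mulrBl mulVf ?gt_eqF//; lra.
  - by rewrite ler_pdivrMr// mulrC.
  - by rewrite uE; exact: hG.
have KLu : 0 <= K * L * u by rewrite !mulr_ge0//; lra.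
have hDf : `|D / fx| <= 6 / fx * L / q ^+ 2.
  rewrite normrM (gtr0_norm (_ : 0 < fx^-1)) ?invr_gt0//.
  apply: le_trans (ler_wpM2r _ hD) _; first by rewrite invr_ge0 ltW.
  by rewrite le_eqVlt; apply/orP; left; apply/eqP; field; lra.
have [|h [h1 h2 hh]] := grid (- (D / fx) + K * L * u).
  by apply: le_trans (ler_normD _ _) _; rewrite normrN (ger0_norm KLu) lerD2r.
have [|k [k1 k2 hk]] := grid (- (D / fx) - K * L * u).
  by apply: le_trans (ler_normD _ _) _; rewrite !normrN (ger0_norm KLu) lerD2r.
have fD : fx * (D / fx) = D by field; lra.
have Lu : u <= L * u by rewrite ler_peMl// ltW.
have pG : p <= G (xi + h).
  move: hh; rewrite ler_norml => /andP[hh _].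
  have := ler_wpM2l (ltW fx0) h1.
  have -> : fx * (- (D / fx) + K * L * u - u) = - D + (K3 + fx) * (L * u) - fx * u.
    by rewrite -fK mulrBr mulrDr mulrN fD; ring.
  have := ler_wpM2l (ltW fx0) Lu.
  by rewrite /D; lra.
have Gp : G (xi + k) < p.
  move: hk; rewrite ler_norml => /andP[_ hk].
  have := ler_wpM2l (ltW fx0) k2.
  have -> : fx * (- (D / fx) - K * L * u) = - D - (K3 + fx) * (L * u).
    by rewrite -fK mulrBr mulrN fD; ring.
  have : 0 < fx * (L * u) by rewrite !mulr_gt0//; lra.
  by rewrite /D; lra.
have /andP[b1 b2] := quantile_between mG pG Gp.
have -> : (K3 / fx + 2) * L / q ^+ 3 = K * L * u + L * u by rewrite KE uE; ring.
by rewrite ler_norml; lra.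
Qed.

(** At the grid points the Taylor error is at most M K1^2 L^2 / q^4 <= L / q^3, so replacing the
    increments of F by linear ones adds 1 to [K2]. *)
Lemma bahadur_of_oscillation (R : realType) (F f G : R -> R)
    (xi p delta M q L K1 K2 : R) :
  {homo G : x y / x <= y} -> 0 < f xi ->
  (forall x, xi - delta < x < xi + delta -> is_derive x 1 F (f x)) ->
  (forall x, xi - delta < x < xi + delta -> derivable f x 1) ->
  (forall x, xi - delta < x < xi + delta -> `|derive1 f x| <= M) ->
  K1 = 6 / f xi + 2 -> 1 <= L -> 1 <= q -> 0 <= K2 -> 0 <= M ->
  (K2 + 1) / f xi + 1 <= q -> K1 * L / q ^+ 2 < delta -> M * K1 ^+ 2 * L <= q ->
  `|G xi - p| <= 6 * L / q ^+ 2 ->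
  (forall j : int, `|j%:~R| <= K1 * L * q ->
     `|G (xi + j%:~R / q ^+ 3) - G xi - (F (xi + j%:~R / q ^+ 3) - F xi)| <=
     K2 * L / q ^+ 3) ->
  `|quantile G p - (xi - (G xi - p) / f xi)| <= ((K2 + 1) / f xi + 2) * L / q ^+ 3.
Proof.
move=> mG fx0 dF df fM K1E L1 q1 K20 M0 Kq hdelta hM hD hG.
apply: bahadur_of_increments => //; first lra.
rewrite -K1E => j jK; have {hG} hG := hG j jK.
have q30 : 0 < q ^+ 3 by rewrite exprn_gt0//; lra.
have hq : `|j%:~R / q ^+ 3| <= K1 * L / q ^+ 2.
  rewrite normrM (gtr0_norm (_ : 0 < (q ^+ 3)^-1)) ?invr_gt0// ler_pdivrMr//.
  by apply: le_trans jK _; rewrite le_eqVlt; apply/orP; left; apply/eqP; field; lra.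
move: (j%:~R / q ^+ 3) hG hq => h hG hq.
have hT : `|F (xi + h) - F xi - f xi * h| <= L / q ^+ 3.
  apply: le_trans (taylor2_window dF df fM (le_lt_trans hq hdelta)) _.
  rewrite -[h ^+ 2]real_normK ?num_real//.
  apply: (@le_trans _ _ (M * (K1 * L / q ^+ 2) ^+ 2)).
    by apply: ler_wpM2l => //; apply: lerXn2r; rewrite ?nnegrE//; exact: le_trans hq.
  have -> : M * (K1 * L / q ^+ 2) ^+ 2 = (M * K1 ^+ 2 * L) * (L / q ^+ 4).
    by field; lra.
  have -> : L / q ^+ 3 = q * (L / q ^+ 4) by field; lra.
  by apply: ler_wpM2r => //; rewrite divr_ge0 ?exprn_ge0//; lra.
have -> : G (xi + h) - G xi - f xi * h =
  (G (xi + h) - G xi - (F (xi + h) - F xi)) + (F (xi + h) - F xi - f xi * h) by ring.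
apply: le_trans (ler_normD _ _) _; apply: le_trans (lerD hG hT) _.
by rewrite -!mulrDl le_eqVlt; apply/orP; left; apply/eqP; ring.
Qed.

(** The inequality n <= (2q)^4 raised to the power 3/4. *)
Lemma root4_powR (R : realType) (n : nat) : (0 < n)%N ->
  ((root4 n)%:R ^+ 3)^-1 <= 8 * (n%:R `^ (- (3 / 4))) :> R.
Proof.
move=> n0.
have q1 : (1 <= root4 n)%N by apply: root4_large; rewrite exp1n.
have n1 : 0 < n%:R :> R by rewrite ltr0n.
have q0 : 0 < (root4 n)%:R :> R by rewrite ltr0n.
have h : n%:R `^ (3 / 4) <= 8 * (root4 n)%:R ^+ 3 :> R.
  have -> : 8 * (root4 n)%:R ^+ 3 = ((2 * (root4 n)%:R) `^ 4%:R) `^ (3 / 4) :> R.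
    rewrite -powRrM (_ : 4%:R * (3 / 4) = 3%:R); last by field.
    by rewrite powR_mulrn ?mulr_ge0//; ring.
  have e0 : 0 <= 3 / 4 :> R by lra.
  apply: (ge0_ler_powR e0); rewrite ?nnegrE ?powR_ge0//.
  rewrite powR_mulrn ?mulr_ge0//.
  have -> : (2 * (root4 n)%:R) ^+ 4 = (16 * (root4 n) ^ 4)%N%:R :> R.
    by rewrite natrM natrX; ring.
  by rewrite ler_nat; exact: root4_ub.
have p0 : 0 < n%:R `^ (3 / 4) :> R by exact: powR_gt0.
rewrite powRN ler_pdivlMr// mulrC ler_pdivrMr// exprn_gt0//.
Qed.

Lemma root4_eventually (R : realType) (K delta M : R) : 0 < K -> 0 < delta -> 0 <= M ->
  exists N : nat, forall n, (N <= n)%N -> let L := ln n%:R : R in let q := (root4 n)%:R : R in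
  [/\ 1 <= L, 1 <= q, K * L / q ^+ 2 < delta, K * L <= q & M * K ^+ 2 * L <= q].
Proof.
move=> K0 delta0 M0.
(* Each summand yields one of the three bounds, the others being nonnegative; the 2 in
   [2 * K / delta] makes the first bound strict. Below, n >= 4 >= e gives 1 <= L. *)
have [N HN] := ln_root4_small (2 * K / delta + K + M * K ^+ 2).
exists (maxn 4 N) => n; rewrite geq_max => /andP[n4 /HN] + L q; rewrite -/L -/q.
have L1 : 1 <= L.
  rewrite /L -[leLHS]expRK ler_ln ?posrE ?expR_gt0 ?ltr0n//; last exact: leq_trans n4.
  apply: (@le_trans _ _ 4%:R); last by rewrite ler_nat.
  by have := @expR_le_quad R 1; lra.
have q1 : 1 <= q by rewrite /q ler1n; apply: root4_large; exact: leq_trans n4.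
move: {HN n n4} L q L1 q1 => L q L1 q1.
have h1 : 0 <= 2 * K / delta * L by apply: mulr_ge0; [apply: divr_ge0; lra|lra].
have h2 : 0 <= K * L by rewrite mulr_ge0//; lra.
have h3 : 0 <= M * K ^+ 2 * L.
  by apply: mulr_ge0; [apply: mulr_ge0 => //; exact: sqr_ge0|lra].
rewrite [leLHS]mulrDl [X in X + _ <= _]mulrDl => h.
split => //; [|lra|lra].
rewrite ltr_pdivrMr ?exprn_gt0//; last lra.
have : K * L <= delta / 2 * q.
  have -> : K * L = delta / 2 * (2 * K / delta * L) by field; lra.
  by apply: ler_wpM2l => //; lra.
have : delta / 2 * q <= delta / 2 * q ^+ 2.
  by apply: ler_wpM2l; [lra|rewrite ler_eXnr].
have : 0 < delta / 2 * q ^+ 2 by rewrite mulr_gt0 ?exprn_gt0//; lra.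
by lra.
Qed.

Theorem theorem2p2 (d : measure_display) (T : measurableType d) (R : realType)
  (P : probability T R) (X : nat -> T -> R) (F : R -> R) (p : R)
  (f : R -> R) (delta : R) :
  (forall i, (1 <= i)%N -> measurable_fun setT (X i)) ->
  (forall i, (1 <= i)%N -> forall x, P [set w | X i w <= x] = (F x)%:E) ->
  (forall i j, (1 <= i)%N -> (1 <= j)%N -> i != j ->
      P [set w | X i w = X j w] = 0%E) ->
  (exists C : R, exists N : nat, forall n, (N <= n)%N ->
      phi_mix P X n <= C / (n%:R ^+ 3)) ->
  0 < p < 1 ->
  0 < delta ->
  (forall x, quantile F p - delta < x < quantile F p + delta ->
     [/\ 0 < f x, {for x, continuous f}, is_derive x 1 F (f x) & derivable f x 1]) ->
  (exists M : R, 0 < M /\ forall x, quantile F p - delta < x < quantile F p + delta ->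
      f x <= M) ->
  (exists M : R, forall x, quantile F p - delta < x < quantile F p + delta ->
      `| derive1 f x | <= M) ->
  {ae P, forall w, exists C : R, exists N : nat, forall n, (N <= n)%N ->
     `| quantile (emp_df X n w) p
        - (quantile F p - (emp_df X n w (quantile F p) - p) / f (quantile F p)) |
       <= C * (n%:R `^ (- (3 / 4))) * ln (n%:R)}.
Proof.
move=> mX FE _ phi_rate p01 delta0 Hf [M [M0 fM]] [M' fM'].
set xi := quantile F p in Hf fM fM' *.
have wxi : xi - delta < xi < xi + delta by apply/andP; split; lra.
have [fx0 _ dFxi _] := Hf _ wxi.
have dF x : xi - delta < x < xi + delta -> is_derive x 1 F (f x) by move=> /Hf[].
have df x : xi - delta < x < xi + delta -> derivable f x 1 by move=> /Hf[].
have M'0 : 0 <= M' by apply: le_trans (fM' _ wxi).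
have Fxi : F xi = p.
  apply: (df_quantile (mX 1%N isT) (FE 1%N isT) p01).
  by apply: differentiable_continuous; apply/derivable1_diffP; exact: (@ex_derive _ _ _ _ _ _ _ dFxi).
have F_itv i a b : (1 <= i)%N -> a <= b -> P (X i @^-1` `]a, b]) = (F b - F a)%:E.
  by move=> i1 ab; exact: (df_itv (mX i i1) (FE i i1)).
have F_ray i : (1 <= i)%N -> P (X i @^-1` `]-oo, xi]) = p%:E.
  by move=> i1; rewrite -sublevelE FE// Fxi.
pose q (n : nat) : R := (root4 n)%:R.
pose L (n : nat) : R := ln n%:R.
have [K1 K1E] : exists K1 : R, K1 = 6 / f xi + 2 by eexists.
have K10 : 0 < K1 by rewrite K1E; have := divr_ge0 (ler0n R 6) (ltW fx0); lra.
(* Indices of the grid points within K1 L / q^2 of xi, on either side; [K1] is the constant of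
   [bahadur_of_increments]. *)
pose J n j := j%:R <= K1 * L n * q n.
pose hh n j : R := j%:R / q n ^+ 3.
have [N1 large] := root4_eventually K10 delta0 M'0.
have small n j : (N1 <= n)%N -> J n j ->
    hh n j <= K1 * L n / q n ^+ 2 /\ hh n j < delta.
  move=> /large[_ q1 hd _ _] Jj.
  have q0 : 0 < q n := lt_le_trans ltr01 q1.
  suff h1 : hh n j <= K1 * L n / q n ^+ 2 by split => //; exact: le_lt_trans hd.
  rewrite /hh ler_pdivrMr ?exprn_gt0//; apply: le_trans Jj _.
  by rewrite le_eqVlt; apply/orP; left; apply/eqP; field; rewrite gt_eqF.
have hh0 n j : 0 <= hh n j by rewrite /hh divr_ge0// exprn_ge0.
have in_window n j : (N1 <= n)%N -> J n j ->
    xi - delta < xi - hh n j < xi + delta /\ xi - delta < xi + hh n j < xi + delta.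
  move=> Nn Jj; have [_ hd] := small n j Nn Jj; have h0 := hh0 n j.
  by split; apply/andP; split; lra.
have beta_le n j : (N1 <= n)%N -> J n j ->
    M * hh n j <= M * K1 * L n / q n ^+ 2.
  move=> Nn Jj; have [h1 _] := small n j Nn Jj.
  by rewrite -!(mulrA M); apply: ler_wpM2l; first exact: ltW.
have MK0 : 0 <= M * K1 by rewrite mulr_ge0// ltW.
(* Increments to the right of xi, then to its left: since f <= M, the intervals have probability at
   most M h <= M K1 L / q^2, as [ae_dev_local] requires. *)
have [K2 K20 aeR] : exists2 K2 : R, 0 <= K2 & {ae P, forall w, exists N : nat,
    forall n, (N <= n)%N -> forall j, (j <= n)%N -> J n j ->
    `|dev X `]xi, xi + hh n j] (F (xi + hh n j) - F xi) n w| <= K2 * L n * q n}.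
  apply: (@ae_dev_local _ _ _ P X mX phi_rate (fun n j => `]xi, xi + hh n j]%classic)
    (fun n j => F (xi + hh n j) - F xi) J (M * K1) (N1)) => //.
  - by move=> n j i i1; apply: F_itv => //; rewrite lerDl.
  - move=> n j Nn Jj; apply: le_trans (beta_le n j Nn Jj).
    have [_ w2] := in_window n j Nn Jj.
    apply: le_trans (df_lipschitz_window dF fM wxi w2 _) _; first by rewrite lerDl.
    by rewrite addrAC subrr add0r.
have [K2' K20' aeL] : exists2 K2 : R, 0 <= K2 & {ae P, forall w, exists N : nat,
    forall n, (N <= n)%N -> forall j, (j <= n)%N -> J n j ->
    `|dev X `]xi - hh n j, xi] (F xi - F (xi - hh n j)) n w| <= K2 * L n * q n}.
  apply: (@ae_dev_local _ _ _ P X mX phi_rate (fun n j => `]xi - hh n j, xi]%classic)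
    (fun n j => F xi - F (xi - hh n j)) J (M * K1) (N1)) => //.
  - by move=> n j i i1; apply: F_itv => //; rewrite gerBl.
  - move=> n j Nn Jj; apply: le_trans (beta_le n j Nn Jj).
    have [w1 _] := in_window n j Nn Jj.
    apply: le_trans (df_lipschitz_window dF fM w1 wxi _) _; first by rewrite gerBl.
    by rewrite opprB addrCA subrr addr0.
have p1 : p <= 1 by case/andP: p01 => _ /ltW.
have aeC := @ae_dev_global _ _ _ P X mX phi_rate `]-oo, xi]%classic p (measurable_itv _) p1 F_ray.
have [K3 K3E] : exists K3 : R, K3 = K2 + K2' by eexists.
(* [Q] exceeds the constant that q must dominate in [bahadur_of_oscillation]. *)
pose Q := (Num.truncn ((K3 + 1) / f xi + 1)).+1.
apply: filterS3 aeC aeR aeL => w [NC HC] [NR HR] [NL HL].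
exists (8 * ((K3 + 1) / f xi + 2)), (maxn (maxn N1 (Q ^ 4)) (maxn NC (maxn NR NL))) => n.
rewrite !geq_max => /and3P[/andP[Nn nQ] nC /andP[nR nL]].
have [L1 q1 hd hK1 hM'] := large n Nn.
rewrite -/(L n) in L1 hd hK1 hM'; rewrite -/(q n) in q1 hd hK1 hM'.
have q0 : 0 < q n := lt_le_trans ltr01 q1.
have L0 : 0 <= L n := le_trans ler01 L1.
have n0 : (0 < n)%N by apply: leq_trans nQ; rewrite expn_gt0.
have q40 : 0 < q n ^+ 4 by rewrite exprn_gt0.
have qL0 : 0 <= L n * q n by rewrite mulr_ge0// ltW.
have q4n : q n ^+ 4 <= n%:R by rewrite /q -natrX ler_nat; case/andP: (root4P n).
(* Since q^4 <= n, dividing by n is at least as good as dividing by q^4. *)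
have mean_dev (x c : R) : 0 <= c -> `|x| <= c -> `|n%:R^-1 * x| <= c / q n ^+ 4.
  move=> c0 xc; rewrite normrM ger0_norm// mulrC; apply: ler_pM => //.
  by rewrite lef_pV2 ?posrE// ltr0n.
have K30 : 0 <= K3 by rewrite K3E addr_ge0.
apply: (@le_trans _ _ (((K3 + 1) / f xi + 2) * L n / q n ^+ 3)); last first.
  rewrite -/(L n).
  have -> : 8 * ((K3 + 1) / f xi + 2) * n%:R `^ (- (3 / 4)) * L n =
     ((K3 + 1) / f xi + 2) * L n * (8 * n%:R `^ (- (3 / 4))) by ring.
  apply: ler_wpM2l; last exact: root4_powR.
  by rewrite mulr_ge0// addr_ge0// divr_ge0 ?addr_ge0// ltW.
apply: (bahadur_of_oscillation _ fx0 dF df fM' K1E) => //.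
- exact: emp_df_nondecreasing.
- apply: (@le_trans _ _ Q%:R); first by rewrite /Q; apply/ltW/Num.Theory.truncnS_gt.
  by rewrite /q ler_nat; exact: root4_large.
- rewrite emp_df_dev//; apply: le_trans (mean_dev _ (6 * q n ^+ 2 * L n) _ (HC n nC)) _.
    by apply: mulr_ge0; [apply: mulr_ge0 => //; exact: sqr_ge0|].
  by rewrite -/(L n) le_eqVlt; apply/orP; left; apply/eqP; field; rewrite gt_eqF.
move=> j jK.
pose m := absz j.
have jm : `|j%:~R| = m%:R :> R by rewrite -intr_norm -abszE.
have Jm : J n m by rewrite /J -jm.
(* The index is at most K1 L q <= q^2 <= q^4 <= n, within the range of the union bound. *)
have mn : (m <= n)%N.
  rewrite -(ler_nat R); apply: le_trans Jm _; apply: le_trans q4n.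
  apply: (@le_trans _ _ (q n * q n)); first by apply: ler_wpM2r => //; exact: ltW.
  by rewrite -expr2 ler_weXn2l.
have inc (x c : R) : c <= K3 -> `|x| <= c * L n * q n ->
    `|n%:R^-1 * x| <= K3 * L n / q n ^+ 3.
  move=> cK xc.
  have -> : K3 * L n / q n ^+ 3 = K3 * (L n * q n) / q n ^+ 4 by field; rewrite gt_eqF.
  apply: mean_dev; first exact: mulr_ge0.
  by apply: le_trans xc _; rewrite -mulrA; apply: ler_wpM2r.
(* The sign of j selects the intervals to the right or to the left of xi. *)
have [j0|j0] := leP 0 j.
  have hE : j%:~R / q n ^+ 3 = hh n m by rewrite /hh -jm ger0_norm// ler0z.
  rewrite hE emp_df_dev_itv//; last by rewrite lerDl.
  by apply: (inc _ K2); [rewrite K3E lerDl|exact: HR].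
have hE : j%:~R / q n ^+ 3 = - hh n m.
  by rewrite /hh -jm ltr0_norm ?ltrz0// mulNr opprK.
rewrite hE.
have -> : emp_df X n w (xi - hh n m) - emp_df X n w xi - (F (xi - hh n m) - F xi) =
  - (emp_df X n w xi - emp_df X n w (xi - hh n m) - (F xi - F (xi - hh n m))) by ring.
rewrite normrN emp_df_dev_itv//; last by rewrite gerBl.
by apply: (inc _ K2'); [rewrite K3E lerDr|exact: HL].
Qed.
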